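(* Let $U:\mathbb{R}^d\to\mathbb{R}$ satisfy the following two conditions. (i) $U$ is twice continuously differentiable, $\nabla U(0)=0$, and there is $\mathtt{L}\ge 0$ with $\sup_{x\in\mathbb{R}^d}\|\mathrm{D}^2U(x)\|\le \mathtt{L}$. (ii) There exist $\mathtt{m}>0$ and $\mathtt{K}\ge 0$ such that $\mathrm{D}^2U(x)[y,y]\ge \mathtt{m}$ for all $x,y\in\mathbb{R}^d$ with $\|x\|\ge \mathtt{K}$ and $\|y\|=1$. Let $\bar\eta=\mathtt{m}/16$ and $V_{\bar\eta}(x)=\exp(\bar\eta\|x\|^2)$. Then there exists $\Gamma>0$ such that for every $\gamma\in(0,\Gamma]$ there exist $C_\gamma\ge 0$ and $\rho_\gamma\in[0,1)$ such that for all $x\in\mathbb{R}^d$ and all $k\in\mathbb{N}$, $$\|\delta_x R_\gamma^k-\pi\|_{V_{\bar\eta}}\le C_\gamma\rho_\gamma^k V_{\bar\eta}(x).$$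
   Context: $\pi$ denotes the probability density on $\mathbb{R}^d$ proportional to $e^{-U}$ (the paper assumes $\pi$ is a positive probability density with $U=-\log\pi$), and also the associated probability measure. For $\gamma>0$, let $r_\gamma(x,y)=(4\pi\gamma)^{-d/2}\exp(-\|y-x+\gamma\nabla U(x)\|^2/(4\gamma))$ and $\alpha_\gamma(x,y)=1\wedge \frac{\pi(y)r_\gamma(y,x)}{\pi(x)r_\gamma(x,y)}$. The MALA Markov kernel is $R_\gamma(x,A)=\int \mathbb{1}_A(y)\alpha_\gamma(x,y)r_\gamma(x,y)\,dy+\delta_x(A)\int\{1-\alpha_\gamma(x,y)\}r_\gamma(x,y)\,dy$. For a measurable $V:\mathbb{R}^d\to[1,\infty)$ and a finite signed measure $\mu$, $\|\mu\|_V=\sup\{|\int f\,d\mu|: f \text{ measurable}, \sup_x|f(x)|/V(x)\le 1\}$. *)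

(* Defs.v *)
From HB Require Import structures.
From mathcomp Require Import all_boot all_order all_algebra.
From mathcomp Require Import all_classical all_reals all_analysis.
Set Implicit Arguments. Unset Strict Implicit. Unset Printing Implicit Defensive.
Import Order.TTheory GRing.Theory Num.Theory.
Import numFieldNormedType.Exports.
Local Open Scope classical_set_scope.
Local Open Scope ring_scope.

Section MALA.
Variables (R : realType) (d : nat).
Notation vec := 'rV[R]_d.

Definition dotv (x y : vec) : R := \sum_(i < d) x 0 i * y 0 i.
Definition enorm (x : vec) : R := Num.sqrt (dotv x x).

Definition evec (i : 'I_d) : vec := delta_mx 0 i.

Definition grad (U : vec -> R) (x : vec) : vec := \row_i ('D_(evec i) U) x.
Definition hess (U : vec -> R) (x y z : vec) : R := 'D_z ('D_y U) x.

Definition C2 (U : vec -> R) : Prop :=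
  (forall x, differentiable U x) /\
  (forall v x, differentiable ('D_v U) x) /\
  (forall v w, continuous ('D_w ('D_v U))).

(* Borel measurability on R^d (product sigma-algebra on d-tuples of reals) *)
Definition row_of_tuple (t : d.-tuple R) : vec := \row_i tnth t i.
Definition meas_fun (f : vec -> R) : Prop :=
  measurable_fun setT (f \o row_of_tuple).

(* Lebesgue integral over R^d of a [0,+oo]-valued function, as the iterated
   integral w.r.t. the one-dimensional Lebesgue measure (Tonelli). *)
Fixpoint iint (n : nat) (g : seq R -> \bar R) : \bar R :=
  match n with
  | 0%N => g [::]
  | n'.+1 => (\int[@lebesgue_measure R]_t iint n' (fun s => g (t :: s)))%E
  end.
Definition leb_int (f : vec -> \bar R) : \bar R :=
  iint d (fun s => f (\row_i nth 0 s i)).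

Definition Zconst (U : vec -> R) : R := fine (leb_int (fun x => (expR (- U x))%:E)).
Definition dens (U : vec -> R) (x : vec) : R := expR (- U x) / Zconst U.

Definition prop_dens (U : vec -> R) (g : R) (x y : vec) : R :=
  powR (4 * pi * g) (- (d%:R / 2)) *
  expR (- (enorm (y - x + g *: grad U x) ^+ 2) / (4 * g)).
Definition accept (U : vec -> R) (g : R) (x y : vec) : R :=
  Num.min 1 ((dens U y * prop_dens U g y x) / (dens U x * prop_dens U g x y)).

(* action of the MALA kernel R_gamma on nonnegative functions:
   (R_gamma f)(x) = int f(y) a(x,y) r(x,y) dy + f(x) (1 - int a(x,y) r(x,y) dy) *)
Definition mala_op (U : vec -> R) (g : R) (f : vec -> \bar R) (x : vec) : \bar R :=
  (leb_int (fun y => f y * (accept U g x y * prop_dens U g x y)%:E) +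
   f x * (1 - leb_int (fun y => (accept U g x y * prop_dens U g x y)%:E)))%E.

(* int f d(delta_x R_gamma^k), for f : vec -> R, via positive/negative parts *)
Definition pos_part (f : vec -> R) : vec -> \bar R := fun y => (Num.max (f y) 0)%:E.
Definition neg_part (f : vec -> R) : vec -> \bar R := fun y => (Num.max (- f y) 0)%:E.
Definition mala_iter_int (U : vec -> R) (g : R) (k : nat) (f : vec -> R) (x : vec) : \bar R :=
  (iter k (mala_op U g) (pos_part f) x - iter k (mala_op U g) (neg_part f) x)%E.

Definition pi_int (U : vec -> R) (f : vec -> R) : \bar R :=
  (leb_int (fun y => pos_part f y * (dens U y)%:E) -
   leb_int (fun y => neg_part f y * (dens U y)%:E))%E.

Definition Vnorm_dist (U : vec -> R) (g : R) (V : vec -> R) (x : vec) (k : nat) : \bar R :=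
  ereal_sup [set `| mala_iter_int U g k f x - pi_int U f |%E
            | f in [set f : vec -> R | meas_fun f /\ forall y, `|f y| <= V y]].

End MALA.

(* Main.v *)
(* For a move from x to y put d = y - x and let w = d + g grad U(x) be its Gaussian
   part. Minus the log acceptance ratio of the move is
     [U(y) - U(x) - <d, grad U(y)>] + <grad U(y) - grad U(x), w>/2
       + g |grad U(y) - grad U(x)|^2/4.
   Outside the ball of radius K the bracket is at most -m|d|^2/2, while the other
   terms are at most L|d||w|/2 + g L^2|d|^2/4. Far from the origin |d| dominates |w|,
   so for g small every move with bounded w is accepted, and the rejection probability
   stays away from 1. As the Euler step x - g grad U(x) contracts |x|, the proposal
   integrates V to o(V(x)). Together these give R_g V <= lam V + b with lam < 1, for
   each g below an explicit threshold. Sublevel sets of V are small for R_g, with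
   Lebesgue measure on a unit cube as minorizing measure, and Harris' theorem applies.
   Only nonnegative test functions are needed, since f splits into its positive and
   negative parts; Harris' theorem is therefore proved for monotone additive operators
   on a cone of nonnegative functions. *)

Require Import Defs.
From HB Require Import structures.
From mathcomp Require Import all_boot all_order all_algebra.
From mathcomp Require Import all_classical all_reals all_analysis.
From mathcomp Require Import measurable_realfun ring lra.
Import Order.TTheory GRing.Theory Num.Theory.
Import numFieldNormedType.Exports.
Local Open Scope classical_set_scope.
Local Open Scope ring_scope.

Set Implicit Arguments.
Unset Strict Implicit.
Unset Printing Implicit Defensive.

(** * Iterated Lebesgue integrals: measurability, linearity and Tonelli *)

Section iterated_integral.
Context {R : realType}.
Local Open Scope ereal_scope.
Notation mu := (@lebesgue_measure R).
Implicit Types (n : nat) (g h : seq R -> \bar R).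

(** [iint n] evaluates its integrand at sequences of length [n] alone, so measurability is asked on
    tuples only. *)
Definition seq_measurable n g :=
  measurable_fun [set: n.-tuple R] (fun t : n.-tuple R => g t).

Lemma iint_ge0 n g : (forall s, 0 <= g s) -> 0 <= iint n g.
Proof.
elim: n g => [|n IH] g g0 //=.
by apply: integral_ge0 => t _; apply: IH.
Qed.

Lemma eq_iint n g h : (forall s, size s = n -> g s = h s) -> iint n g = iint n h.
Proof.
elim: n g h => [|n IH] g h gh /=; first exact: gh.
by apply: eq_integral => t _; apply: IH => s sn; apply: gh; rewrite /= sn.
Qed.

Lemma seq_measurable_cons n g t :
  seq_measurable n.+1 g -> seq_measurable n (fun s => g (t :: s)).
Proof.
move=> mg.
apply: (measurableT_comp (f := fun u : n.+1.-tuple R => g u)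
  (g := fun s : n.-tuple R => [the n.+1.-tuple R of t :: s]) mg).
exact: measurable_cons.
Qed.

(** The parameter space is arbitrary because the induction moves the first coordinate into it,
    replacing [T] by [T * R]. *)
Lemma measurable_iint n : forall dT (T : measurableType dT) (g : T -> seq R -> \bar R),
  (forall x s, 0 <= g x s) ->
  measurable_fun [set: T * n.-tuple R] (fun p => g p.1 p.2) ->
  measurable_fun [set: T] (fun x => iint n (g x)).
Proof.
elim: n => [|n IH] dT T g g0 mg /=.
  apply: (measurableT_comp (f := fun p : T * 0.-tuple R => g p.1 p.2)
    (g := fun x : T => (x, [tuple] : 0.-tuple R)) mg).
  exact/measurable_fun_pair.
apply: (@measurable_fun_fubini_tonelli_F _ _ _ _ _ mu
  (fun p : T * R => iint n (fun s => g p.1 (p.2 :: s)))).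
- apply: (IH _ (T * R)%type (fun p s => g p.1 (p.2 :: s))) => //.
  apply: (measurableT_comp (f := fun p : T * n.+1.-tuple R => g p.1 p.2)
    (g := fun q : (T * R) * n.-tuple R =>
       (q.1.1, [the n.+1.-tuple R of q.1.2 :: q.2])) mg).
  apply/measurable_fun_pair; first exact: measurableT_comp.
  by apply: measurable_cons => //; exact: measurableT_comp.
- by move=> x; apply: iint_ge0.
Qed.

Lemma measurable_iint_cons n g : (forall s, 0 <= g s) -> seq_measurable n.+1 g ->
  measurable_fun [set: R] (fun t => iint n (fun s => g (t :: s))).
Proof.
move=> g0 mg; apply: (@measurable_iint n _ R (fun t s => g (t :: s))) => //.
apply: (measurableT_comp (f := fun p : n.+1.-tuple R => g p)
    (g := fun q : R * n.-tuple R => [the n.+1.-tuple R of q.1 :: q.2]) mg).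
exact: measurable_cons.
Qed.

Lemma le_iint n g h : (forall s, 0 <= g s) -> (forall s, 0 <= h s) ->
  seq_measurable n g -> seq_measurable n h ->
  (forall s, size s = n -> g s <= h s) -> iint n g <= iint n h.
Proof.
elim: n g h => [|n IH] g h g0 h0 mg mh gh /=; first exact: gh.
apply: ge0_le_integral => //.
- by move=> t _; apply: iint_ge0.
- exact: measurable_iint_cons.
- exact: measurable_iint_cons.
- move=> t _; apply: IH => // [||s sn]; last by apply: gh; rewrite /= sn.
  all: exact: seq_measurable_cons.
Qed.

Lemma iintD n g h : (forall s, 0 <= g s) -> (forall s, 0 <= h s) ->
  seq_measurable n g -> seq_measurable n h ->
  iint n (fun s => g s + h s) = iint n g + iint n h.
Proof.
elim: n g h => [|n IH] g h g0 h0 mg mh //=.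
rewrite -ge0_integralD//; first last.
- exact: measurable_iint_cons.
- by move=> t _; apply: iint_ge0.
- exact: measurable_iint_cons.
- by move=> t _; apply: iint_ge0.
by apply: eq_integral => t _; apply: IH => //; exact: seq_measurable_cons.
Qed.

Lemma iintZl n g (k : \bar R) : 0 <= k -> (forall s, 0 <= g s) -> seq_measurable n g ->
  iint n (fun s => k * g s) = k * iint n g.
Proof.
move=> k0; elim: n g => [|n IH] g g0 mg //=.
rewrite -ge0_integralZl//; first last.
- by move=> t _; apply: iint_ge0.
- exact: measurable_iint_cons.
by apply: eq_integral => t _; apply: IH => //; exact: seq_measurable_cons.
Qed.

(** Tonelli for one extra real variable; [iint_swap] uses it once per coordinate of its second
    block. *)
Lemma iint_integral_swap n (G : seq R -> R -> \bar R) :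
  (forall s t, 0 <= G s t) ->
  measurable_fun [set: n.-tuple R * R] (fun p => G p.1 p.2) ->
  iint n (fun s => \int[mu]_t G s t) = \int[mu]_t iint n (fun s => G s t).
Proof.
elim: n G => [|n IH] G G0 mG //=.
transitivity (\int[mu]_u \int[mu]_t iint n (fun s => G (u :: s) t)).
  apply: eq_integral => u _; apply: IH => //.
  apply: (measurableT_comp (f := fun p : n.+1.-tuple R * R => G p.1 p.2)
    (g := fun q : n.-tuple R * R => ([the n.+1.-tuple R of u :: q.1], q.2)) mG).
  by apply/measurable_fun_pair => //; exact: measurable_cons.
apply: (@fubini_tonelli _ _ _ _ _ mu mu
  (fun p : R * R => iint n (fun s => G (p.1 :: s) p.2))).
- apply: (@measurable_iint n _ (R * R)%type (fun p s => G (p.1 :: s) p.2)) => //.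
  apply: (measurableT_comp (f := fun p : n.+1.-tuple R * R => G p.1 p.2)
    (g := fun q : (R * R) * n.-tuple R =>
       ([the n.+1.-tuple R of q.1.1 :: q.2], q.1.2)) mG).
  apply/measurable_fun_pair; last exact: measurableT_comp.
  by apply: measurable_cons => //; exact: measurableT_comp.
- by move=> p; apply: iint_ge0.
Qed.

Lemma iint_swap n m (G : seq R -> seq R -> \bar R) :
  (forall s t, 0 <= G s t) ->
  measurable_fun [set: n.-tuple R * m.-tuple R] (fun p => G p.1 p.2) ->
  iint n (fun s => iint m (fun t => G s t)) = iint m (fun t => iint n (fun s => G s t)).
Proof.
elim: m G => [|m IH] G G0 mG //=.
rewrite (@iint_integral_swap n (fun s u => iint m (fun t => G s (u :: t)))); first last.
- apply: (@measurable_iint m _ (n.-tuple R * R)%type (fun p t => G p.1 (p.2 :: t))) => //.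
  apply: (measurableT_comp (f := fun p : n.-tuple R * m.+1.-tuple R => G p.1 p.2)
    (g := fun q : (n.-tuple R * R) * m.-tuple R =>
       (q.1.1, [the m.+1.-tuple R of q.1.2 :: q.2])) mG).
  apply/measurable_fun_pair; first exact: measurableT_comp.
  by apply: measurable_cons => //; exact: measurableT_comp.
- by move=> s t; apply: iint_ge0.
apply: eq_integral => u _; apply: IH => //.
apply: (measurableT_comp (f := fun p : n.-tuple R * m.+1.-tuple R => G p.1 p.2)
    (g := fun q : n.-tuple R * m.-tuple R =>
       (q.1, [the m.+1.-tuple R of u :: q.2])) mG).
by apply/measurable_fun_pair => //; exact: measurable_cons.
Qed.

Lemma seq_measurable_prod n (F : nat -> R -> R) :
  (forall i, measurable_fun setT (F i)) ->
  seq_measurable n (fun s => (\prod_(i < n) F i s`_i)%:E).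
Proof.
move=> mF; apply/measurable_EFinP; apply: measurable_prod => i _ /=.
rewrite (_ : (fun _ => _) = (F i) \o (fun t : n.-tuple R => tnth t i)).
  by apply: measurableT_comp => //; exact: measurable_tnth.
by apply/funext => t /=; rewrite (tnth_nth 0%R).
Qed.

Lemma iint_prod n (F : nat -> R -> R) : (forall i x, (0 <= F i x)%R) ->
  (forall i, measurable_fun setT (F i)) ->
  iint n (fun s => (\prod_(i < n) F i s`_i)%:E) = \prod_(i < n) \int[mu]_t (F i t)%:E.
Proof.
elim: n F => [|n IH] F F0 mF /=; first by rewrite !big_ord0.
rewrite big_ord_recl /= -ge0_integralZr//; first last.
- by apply: prode_ge0 => i _; apply: integral_ge0 => t _; rewrite lee_fin.
- by move=> t _; rewrite lee_fin.
- by apply/measurable_EFinP; exact: mF.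
apply: eq_integral => t _.
rewrite -(IH (fun i => F i.+1))// -iintZl//; first last.
- exact: (@seq_measurable_prod n (fun i => F i.+1)).
- by move=> s; rewrite lee_fin prodr_ge0.
- by rewrite lee_fin.
by apply: eq_iint => s _; rewrite big_ord_recl /= EFinM.
Qed.

End iterated_integral.

(** * Euclidean inner product and norm *)

Section euclidean.
Context {R : realType} {d : nat}.
Implicit Types (x y z v : 'rV[R]_d) (c : R).

Lemma dotvC x y : dotv x y = dotv y x.
Proof. by apply: eq_bigr => i _; rewrite mulrC. Qed.

Lemma dotvDl x y z : dotv (x + y) z = dotv x z + dotv y z.
Proof. by rewrite -big_split; apply: eq_bigr => i _; rewrite mxE mulrDl. Qed.

Lemma dotvZl c x y : dotv (c *: x) y = c * dotv x y.
Proof. by rewrite mulr_sumr; apply: eq_bigr => i _; rewrite mxE mulrA. Qed.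

Lemma dotvDr x y z : dotv x (y + z) = dotv x y + dotv x z.
Proof. by rewrite dotvC dotvDl !(dotvC x). Qed.

Lemma dotvZr c x y : dotv x (c *: y) = c * dotv x y.
Proof. by rewrite dotvC dotvZl dotvC. Qed.

Lemma dotvNl x y : dotv (- x) y = - dotv x y.
Proof. by rewrite -scaleN1r dotvZl mulN1r. Qed.

Lemma dotvNr x y : dotv x (- y) = - dotv x y.
Proof. by rewrite dotvC dotvNl dotvC. Qed.

Lemma dotvv_ge0 x : 0 <= dotv x x.
Proof. by apply: sumr_ge0 => i _; rewrite -expr2 sqr_ge0. Qed.

Lemma dotvv_eq0 x : dotv x x = 0 -> x = 0.
Proof.
move=> /eqP; rewrite psumr_eq0; last by move=> i _; rewrite -expr2 sqr_ge0.
move=> /allP x0; apply/rowP => i; rewrite mxE.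
by have := x0 i; rewrite mem_index_enum -expr2 sqrf_eq0 => /(_ isT) /eqP.
Qed.

Lemma enorm_ge0 x : 0 <= enorm x.
Proof. exact: sqrtr_ge0. Qed.

Lemma enorm_sqr x : enorm x ^+ 2 = dotv x x.
Proof. by rewrite sqr_sqrtr// dotvv_ge0. Qed.

Lemma dotv0l x : dotv 0 x = 0.
Proof. by rewrite -(scale0r 0) dotvZl mul0r. Qed.

Lemma enorm0 : enorm (0 : 'rV[R]_d) = 0.
Proof. by rewrite /enorm dotv0l sqrtr0. Qed.

Lemma enorm_eq0 x : enorm x = 0 -> x = 0.
Proof. by move=> x0; apply: dotvv_eq0; rewrite -enorm_sqr x0 expr0n. Qed.

Lemma enormZ c x : enorm (c *: x) = `|c| * enorm x.
Proof. by rewrite /enorm dotvZl dotvZr mulrA -expr2 sqrtrM ?sqr_ge0// sqrtr_sqr. Qed.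

Lemma enorm_lin_sqr (u v : 'rV[R]_d) (s : R) :
  enorm (u + s *: v) ^+ 2 = enorm u ^+ 2 + 2 * s * dotv u v + s ^+ 2 * enorm v ^+ 2.
Proof.
by rewrite !enorm_sqr dotvDl !dotvDr !dotvZl !dotvZr (dotvC v u); ring.
Qed.

Lemma enormN x : enorm (- x) = enorm x.
Proof. by rewrite -scaleN1r enormZ normrN1 mul1r. Qed.

Lemma cauchy_schwarz_dotv x y : `|dotv x y| <= enorm x * enorm y.
Proof.
have [y0|y0] := eqVneq (dotv y y) 0.
  by rewrite (dotvv_eq0 y0) dotvC dotv0l normr0 mulr_ge0// enorm_ge0.
have yy : 0 < dotv y y by rewrite lt_neqAle eq_sym y0 dotvv_ge0.
rewrite -(@ler_pXn2r _ 2)// ?nnegrE ?mulr_ge0 ?enorm_ge0//.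
rewrite exprMn !enorm_sqr real_normK ?num_real//.
(* Up to the factor [dotv y y], this is the component of [x] orthogonal to [y]. *)
have := dotvv_ge0 (dotv y y *: x - dotv x y *: y).
rewrite !(dotvDl, dotvDr, dotvNl, dotvNr, dotvZl, dotvZr) (dotvC y x).
set a := dotv y y in yy *; set b := dotv x y; set e := dotv x x.
rewrite [leRHS](_ : _ = a * (e * a - b ^+ 2)); last by ring.
by rewrite pmulr_rge0// subr_ge0.
Qed.

Lemma enormD x y : enorm (x + y) <= enorm x + enorm y.
Proof.
rewrite -(@ler_pXn2r _ 2)// ?nnegrE ?addr_ge0 ?enorm_ge0//.
rewrite enorm_sqr dotvDl !dotvDr sqrrD -!enorm_sqr (dotvC y).
by have := cauchy_schwarz_dotv x y; rewrite ler_norml => /andP[_]; lra.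
Qed.

Lemma enormB_ge x y : enorm x - enorm y <= enorm (x + y).
Proof. by have := enormD (x + y) (- y); rewrite addrK enormN; lra. Qed.

End euclidean.

(** * Derivatives along lines *)

Section line_calculus.
Context {R : realType} {d : nat}.
Implicit Types (f : 'rV[R]_d -> R) (x v w : 'rV[R]_d).

Lemma is_derive_line f x v (t : R) : differentiable f (x + t *: v) ->
  is_derive t 1 (fun t : R => f (x + t *: v)) ('D_v f (x + t *: v)).
Proof.
move=> df.
have E : (fun h : R => h^-1 *: (((fun t : R => f (x + t *: v)) \o shift t) (h *: 1)
              - (fun t : R => f (x + t *: v)) t)) =
         (fun h : R => h^-1 *: ((f \o shift (x + t *: v)) (h *: v) - f (x + t *: v))).
  by apply/funext => h /=; rewrite [_%:A]mulr1 scalerDl addrCA.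
apply: DeriveDef; last by rewrite /derive E.
by rewrite /derivable E; apply: diff_derivable.
Qed.

Lemma MVT_line f x v (a b : R) : (forall y, differentiable f y) -> a <= b ->
  exists2 c, a <= c <= b &
    f (x + b *: v) - f (x + a *: v) = 'D_v f (x + c *: v) * (b - a).
Proof.
move=> df ab.
have [||c] := @MVT_segment R (fun t => f (x + t *: v))
    (fun t => 'D_v f (x + t *: v)) a b ab.
- by move=> t _; exact: is_derive_line.
- by apply: derivable_within_continuous => t _; have [] := is_derive_line (df (x + t *: v)).
by rewrite in_itv /= => cab ->; exists c.
Qed.

(** The mean value theorem for [f] minus a quadratic primitive of [p + q * t]; it stands in for
    integrating the derivative bound. *)
Lemma affine_derive_le (f df : R -> R) (p q : R) :
  (forall t : R, 0 <= t <= 1 -> is_derive t 1 f (df t)) ->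
  (forall t : R, 0 <= t <= 1 -> df t <= p + q * t) -> f 1 - f 0 <= p + q / 2.
Proof.
move=> fdf dfle.
pose g t := f t - (p * t + q / 2 * t ^+ 2).
have dg (t : R) : 0 <= t <= 1 -> is_derive t 1 g (df t - (p + q * t)).
  move=> /fdf dft; apply: is_derive_eq; rewrite /GRing.scale /=.
  by field.
have [||c] := @MVT_segment R g (fun t => df t - (p + q * t)) 0 1 ler01.
- by move=> t /itvP t01; apply: dg; rewrite !t01.
- by apply: derivable_within_continuous => t /itvP t01; have [|? _] := dg t; rewrite ?t01.
rewrite in_itv /= => /dfle; rewrite /g subr0 mulr1 => h.
by rewrite expr1n expr0n /=; lra.
Qed.

Lemma derive_dotv f x v : differentiable f x -> 'D_v f x = dotv (grad f x) v.
Proof.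
move=> df; rewrite deriveE// [in LHS](row_sum_delta v) linear_sum /=.
apply: eq_bigr => i _; rewrite linearZ /= mxE deriveE// mulrC.
by rewrite /GRing.scale /=.
Qed.

End line_calculus.

(** * Growth and convexity of the potential *)

Section potential.
Context {R : realType} {d : nat}.
Variables (U : 'rV[R]_d -> R) (L m K : R).
Hypothesis UC2 : C2 U.
Hypothesis grad0 : grad U 0 = 0.
Hypothesis L0 : 0 <= L.
Hypothesis hessL : forall x y z, `|hess U x y z| <= L * enorm y * enorm z.
Hypothesis m0 : 0 < m.
Hypothesis K0 : 0 <= K.
Hypothesis hessm : forall x y, K <= enorm x -> enorm y = 1 -> m <= hess U x y y.
Implicit Types x y v : 'rV[R]_d.

Let dU x : differentiable U x. Proof. exact: UC2.1. Qed.
Let ddU v x : differentiable ('D_v U) x. Proof. exact: UC2.2.1. Qed.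

(** Homogeneity reduces to unit vectors: ['D_y U] is linear in [y] by [derive_dotv], so scaling by
    [c] multiplies the Hessian form by [c ^+ 2]. If [y] has norm zero, the bound by [L] makes the
    form vanish. *)
Lemma hess_ge x y : K <= enorm x -> m * enorm y ^+ 2 <= hess U x y y.
Proof.
move=> Kx; have [y0|y0] := eqVneq (enorm y) 0.
  by have := hessL x y y; rewrite y0 !mulr0 normr_le0 expr0n /= mulr0 => /eqP ->.
have [c [e [e1 yE ->]]] : exists c e, [/\ enorm e = 1, y = c *: e & enorm y = c].
  exists (enorm y), ((enorm y)^-1 *: y); split => //.
    by rewrite enormZ ger0_norm ?invr_ge0 ?enorm_ge0// mulVf.
  by rewrite scalerA divff// scale1r.
have DyU : 'D_y U = (fun z => c *: 'D_e U z).
  by apply/funext => z; rewrite !derive_dotv// yE dotvZr.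
have -> : hess U x y y = c ^+ 2 * hess U x e e.
  rewrite /hess DyU deriveE; last exact: differentiableZ.
  rewrite yE linearZ /= -deriveE; last exact: differentiableZ.
  rewrite deriveZ; last exact: diff_derivable.
  by rewrite /GRing.scale /= mulrA -expr2.
by rewrite mulrC ler_wpM2l ?sqr_ge0//; apply: hessm.
Qed.

(** The mean value theorem is applied to the derivative of [U] in the direction of the gradient
    difference [w] itself; cancelling one factor [enorm w] gives the bound. *)
Lemma grad_lipschitz x y : enorm (grad U y - grad U x) <= L * enorm (y - x).
Proof.
set w := grad U y - grad U x.
have [w0|w0] := eqVneq (enorm w) 0; first by rewrite w0 mulr_ge0 ?enorm_ge0.
have wp : 0 < enorm w by rewrite lt_neqAle eq_sym w0 enorm_ge0.
rewrite -(ler_pM2l wp) -expr2 enorm_sqr {1}/w dotvDl dotvNl -!derive_dotv//.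
have [c _] := @MVT_line R d ('D_w U) x (y - x) 0 1 (ddU w) ler01.
rewrite scale1r scale0r addr0 [x + (y - x)]addrC subrK subr0 mulr1 => ->.
have := hessL (x + c *: (y - x)) w (y - x); rewrite ler_norml => /andP[_].
by rewrite /hess mulrA (mulrC (enorm w)).
Qed.

Lemma grad_le x : enorm (grad U x) <= L * enorm x.
Proof. by have := grad_lipschitz 0 x; rewrite grad0 !subr0. Qed.

(** Follow the ray from the origin to [x]. Up to radius [K] the second derivative is only known to
    be at least [- L |x|^2], beyond it is at least [m |x|^2]; the inner piece is a fraction
    [K / |x|] of the segment, which costs [(m + L) K |x|]. *)
Lemma grad_radial x :
  m * enorm x ^+ 2 - (m + L) * K * enorm x <= dotv (grad U x) x.
Proof.
have x0 := enorm_ge0 x.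
rewrite -derive_dotv//.
have D0 : 'D_x U 0 = 0 by rewrite derive_dotv// grad0 dotv0l.
have neg z : - (L * enorm x ^+ 2) <= hess U z x x.
  by have := hessL z x x; rewrite ler_norml -mulrA -expr2 => /andP[].
(* When [|x| < K] the bound by [L] suffices, because [(m + L) |x|^2 <= (m + L) K |x|]. *)
have [Kx|xK] := leP K (enorm x); last first.
  have [c _] := @MVT_line R d ('D_x U) 0 x 0 1 (ddU x) ler01.
  rewrite !add0r scale1r scale0r D0 !subr0 mulr1 => ->.
  apply: le_trans (neg _).
  have : (m + L) * enorm x * enorm x <= (m + L) * enorm x * K.
    apply: ler_wpM2l; last exact: ltW.
    by rewrite mulr_ge0// addr_ge0// ltW.
  by rewrite expr2; lra.
have [xE|xn0] := eqVneq (enorm x) 0.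
  by move: D0; rewrite (enorm_eq0 xE) enorm0 => ->; rewrite expr0n /=; lra.
have xp : 0 < enorm x by rewrite lt_neqAle eq_sym xn0 enorm_ge0.
pose t := K / enorm x.
have t0 : 0 <= t by rewrite divr_ge0.
have t1 : t <= 1 by rewrite ler_pdivrMr// mul1r.
have tx : t * enorm x = K by rewrite divfK.
have [c /andP[c0 ct]] := @MVT_line R d ('D_x U) 0 x 0 t (ddU x) t0.
rewrite !add0r scale0r D0 !subr0 => h1.
have [e /andP[te e1]] := @MVT_line R d ('D_x U) 0 x t 1 (ddU x) t1.
rewrite !add0r scale1r => h2.
have g1 := neg (c *: x).
have g2 : m * enorm x ^+ 2 <= hess U (e *: x) x x.
  apply: hess_ge; rewrite enormZ ger0_norm; last exact: le_trans te.
  by rewrite -tx ler_wpM2r.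
have k1 := ler_wpM2r t0 g1.
have t1' : 0 <= 1 - t by rewrite subr_ge0.
have k2 := ler_wpM2r t1' g2.
have k3 : L * enorm x ^+ 2 * t + m * enorm x ^+ 2 * t = (m + L) * K * enorm x.
  by rewrite -tx; ring.
move: h1 h2 k1 k2 k3; rewrite /hess.
move: ('D_x U x) ('D_x U (t *: x)) => a1 a2.
move: ('D_x ('D_x U) (c *: x)) ('D_x ('D_x U) (e *: x)) => a3 a4.
by clear g1 g2 neg D0; lra.
Qed.

(** Dividing [grad_radial] at [t x] by [t] bounds the slope of [U] along the ray below by
    [t m |x|^2 - (m + L) K |x|]. As [affine_derive_le] bounds from above, it is applied to [- U]. *)
Lemma potential_ge x :
  U 0 + m / 2 * enorm x ^+ 2 - (m + L) * K * enorm x <= U x.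
Proof.
have := @affine_derive_le R (fun t => - U (0 + t *: x)) (fun t => - 'D_x U (0 + t *: x))
  ((m + L) * K * enorm x) (- (m * enorm x ^+ 2)).
rewrite !add0r scale1r scale0r => h.
suff : - U x - - U 0 <= (m + L) * K * enorm x + - (m * enorm x ^+ 2) / 2 by lra.
apply: h => t /andP[t0 t1].
  by have := is_derive_line (dU (0 + t *: x)) => ?; exact: is_deriveN.
rewrite add0r derive_dotv//.
have [->|tn0] := eqVneq t 0.
  rewrite scale0r grad0 dotv0l mulr0 addr0 oppr0 !mulr_ge0 ?enorm_ge0//.
  by rewrite addr_ge0// ltW.
have tp : 0 < t by rewrite lt_neqAle eq_sym tn0.
have := grad_radial (t *: x); rewrite dotvZr enormZ ger0_norm// => hr.
by rewrite -(ler_pM2l tp); lra.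
Qed.

Lemma potential_dist x : `|U x - U 0| <= L * enorm x ^+ 2.
Proof.
have [c /andP[c0 c1]] := @MVT_line R d U 0 x 0 1 dU ler01.
rewrite !add0r scale1r scale0r subr0 mulr1 => ->.
rewrite derive_dotv// (le_trans (cauchy_schwarz_dotv _ _))//.
rewrite expr2 mulrA ler_wpM2r ?enorm_ge0// (le_trans (grad_le _))//.
by rewrite enormZ ger0_norm// ler_wpM2l// ler_piMl ?enorm_ge0.
Qed.

(** The expansion is about the endpoint [x + v]: the slope at time [t] is at most the final slope
    minus [m |v|^2 (1 - t)]. The exterior of a ball is not convex, so the whole segment is required
    to stay there. *)
Lemma segment_strong_convexity x v :
  (forall t, 0 <= t <= 1 -> K <= enorm (x + t *: v)) ->
  U (x + v) - U x - dotv v (grad U (x + v)) <= - (m / 2 * enorm v ^+ 2).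
Proof.
move=> Kseg; rewrite dotvC -derive_dotv//.
have := @affine_derive_le R (fun t => U (x + t *: v)) (fun t => 'D_v U (x + t *: v))
  ('D_v U (x + v) - m * enorm v ^+ 2) (m * enorm v ^+ 2).
rewrite scale1r scale0r addr0 => h.
suff : U (x + v) - U x <= 'D_v U (x + v) - m * enorm v ^+ 2 + m * enorm v ^+ 2 / 2.
  by lra.
apply: h => t /andP[t0 t1]; first exact: is_derive_line.
have [c /andP[tc c1]] := @MVT_line R d ('D_v U) x v t 1 (ddU v) t1.
rewrite scale1r => hc.
have Kc : K <= enorm (x + c *: v) by apply: Kseg; rewrite c1 (le_trans t0 tc).
have t1' : 0 <= 1 - t by rewrite subr_ge0.
have := ler_wpM2r t1' (hess_ge v Kc).
by rewrite /hess; lra.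
Qed.

End potential.

(** * Integration and Borel measurability on row vectors *)

Section lebesgue_vectors.
Context {R : realType} {d : nat}.
Notation vec := 'rV[R]_d.
Implicit Types (f h : vec -> \bar R).

Lemma row_of_tupleE (t : d.-tuple R) : \row_i nth 0 t i = row_of_tuple t.
Proof. by apply/rowP => i; rewrite !mxE (tnth_nth 0). Qed.

Definition emeas_fun f := measurable_fun [set: d.-tuple R] (f \o @row_of_tuple R d).

Definition meas_fun2 (k : vec -> vec -> R) :=
  measurable_fun [set: d.-tuple R * d.-tuple R]
    (fun p => k (row_of_tuple p.1) (row_of_tuple p.2)).

Lemma emeas_funP f : emeas_fun f <-> seq_measurable d (fun s => f (\row_i nth 0 s i)).
Proof.
rewrite /emeas_fun /seq_measurable.
suff -> : f \o @row_of_tuple R d = (fun t : d.-tuple R => f (\row_i nth 0 t i)) by [].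
by apply/funext => t /=; rewrite row_of_tupleE.
Qed.

Lemma meas_fun_EFin (f : vec -> R) : meas_fun f <-> emeas_fun (EFin \o f).
Proof. by rewrite /emeas_fun /meas_fun -compA; exact: iff_sym (measurable_EFinP _ _). Qed.

Lemma leb_int_ge0 f : (forall x, 0 <= f x)%E -> (0 <= leb_int f)%E.
Proof. by move=> f0; apply: iint_ge0. Qed.

Lemma eq_leb_int f h : f =1 h -> leb_int f = leb_int h.
Proof. by move=> fh; apply: eq_iint => s _. Qed.

Lemma le_leb_int f h : (forall x, 0 <= f x)%E -> (forall x, f x <= h x)%E ->
  emeas_fun f -> emeas_fun h -> (leb_int f <= leb_int h)%E.
Proof.
move=> f0 fh /emeas_funP mf /emeas_funP mh; apply: le_iint => //.
by move=> s; exact: le_trans (fh _).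
Qed.

Lemma leb_intD f h : (forall x, 0 <= f x)%E -> (forall x, 0 <= h x)%E ->
  emeas_fun f -> emeas_fun h ->
  leb_int (fun x => f x + h x)%E = (leb_int f + leb_int h)%E.
Proof. by move=> f0 h0 /emeas_funP mf /emeas_funP mh; apply: iintD. Qed.

Lemma leb_intZl (k : R) f : 0 <= k -> (forall x, 0 <= f x)%E -> emeas_fun f ->
  leb_int (fun x => k%:E * f x)%E = (k%:E * leb_int f)%E.
Proof. by move=> k0 f0 /emeas_funP mf; apply: iintZl. Qed.

Lemma leb_int_swap (k : vec -> vec -> R) : (forall x y, 0 <= k x y) -> meas_fun2 k ->
  leb_int (fun x => leb_int (fun y => (k x y)%:E)) =
  leb_int (fun y => leb_int (fun x => (k x y)%:E)).
Proof.
move=> k0 mk; rewrite /leb_int.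
apply: (@iint_swap R d d (fun s t => (k (\row_i nth 0 s i) (\row_i nth 0 t i))%:E)).
  by move=> s t; rewrite lee_fin.
apply/measurable_EFinP; move: mk; rewrite /meas_fun2.
congr measurable_fun; apply/funext => p /=.
by rewrite !row_of_tupleE.
Qed.

Lemma emeas_fun_leb_int (k : vec -> vec -> R) : (forall x y, 0 <= k x y) -> meas_fun2 k ->
  emeas_fun (fun x => leb_int (fun y => (k x y)%:E)).
Proof.
move=> k0 mk; rewrite /emeas_fun /leb_int /comp.
apply: (@measurable_iint R d _ _
  (fun t s => (k (row_of_tuple t) (\row_i nth 0 s i))%:E)).
  by move=> s t; rewrite lee_fin.
apply/measurable_EFinP; move: mk; rewrite /meas_fun2.
congr measurable_fun; apply/funext => p /=.
by rewrite !row_of_tupleE.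
Qed.

Lemma meas_fun2_fst (f : vec -> R) : meas_fun f -> meas_fun2 (fun x _ => f x).
Proof. by move=> mf; apply: (measurableT_comp mf); exact: measurable_fst. Qed.

Lemma meas_fun2_snd (f : vec -> R) : meas_fun f -> meas_fun2 (fun _ y => f y).
Proof. by move=> mf; apply: (measurableT_comp mf); exact: measurable_snd. Qed.

Lemma meas_fun2_swap (k : vec -> vec -> R) : meas_fun2 k -> meas_fun2 (fun x y => k y x).
Proof.
move=> mk; apply: (measurableT_comp
  (f := fun p : d.-tuple R * d.-tuple R => k (row_of_tuple p.1) (row_of_tuple p.2))
  (g := fun p : d.-tuple R * d.-tuple R => (p.2, p.1)) mk).
exact/measurable_fun_pair.
Qed.

Lemma meas_fun2_section (k : vec -> vec -> R) x : meas_fun2 k -> meas_fun (k x).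
Proof.
move=> mk; pose t := [tuple x 0 i | i < d].
have xt : x = row_of_tuple t by apply/rowP => i; rewrite mxE tnth_mktuple.
rewrite xt; apply: (measurableT_comp
  (f := fun p : d.-tuple R * d.-tuple R => k (row_of_tuple p.1) (row_of_tuple p.2))
  (g := fun p : d.-tuple R => (t, p)) mk).
exact/measurable_fun_pair.
Qed.

(* A continuous function is the pointwise limit of its values on finer and finer
   cubic grids, and each of these takes countably many values. *)
Lemma continuous_meas_fun (f : vec -> R) : continuous f -> meas_fun f.
Proof.
move=> cf.
(* The mesh is [1 / (n + 1)]: [q n] gives the integer label of the cube containing a point, and
   [grid n] the lower corner of that cube. *)
pose q n (t : d.-tuple R) : d.-tuple int :=
  [tuple Num.floor (n.+1%:R * tnth t i) | i < d].
pose grid n (z : d.-tuple int) : vec := \row_i ((tnth z i)%:~R / n.+1%:R).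
apply: (@measurable_fun_cvg _ _ R setT (fun n t => f (grid n (q n t)))).
  move=> n _ Y mY; rewrite setTI.
  (* The preimage is a countable union of grid cubes, each a finite intersection of half-open
     slabs. *)
  have -> : (fun t => f (grid n (q n t))) @^-1` Y =
     \bigcup_z (if f (grid n z) \in Y then q n @^-1` [set z] else set0).
    apply/seteqP; split=> [t /= ft|t [z _]].
      by exists (q n t) => //; rewrite mem_set.
    by case: ifPn => //; rewrite inE => fz /= tz; rewrite -tz in fz.
  apply: countable_bigcupT_measurable => //.
  move=> z; case: ifPn => // _.
  have -> : q n @^-1` [set z] = \bigcap_(i in [set: 'I_d])
      ((fun t : d.-tuple R => n.+1%:R * tnth t i) @^-1` `[(tnth z i)%:~R, (tnth z i + 1)%:~R[).
    apply/seteqP; split=> [t /= <- i _ /=|t /= tz].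
      by rewrite in_itv /= tnth_mktuple floor_itv.
    apply: eq_from_tnth => i; rewrite tnth_mktuple; apply/eqP; rewrite floor_eq.
    by have := tz i I; rewrite /= in_itv.
  apply: fin_bigcap_measurable => // i _.
  rewrite -[_ @^-1` _]setTI.
  have : measurable_fun [set: d.-tuple R] (fun t : d.-tuple R => n.+1%:R * tnth t i : R).
    by apply: measurable_funM => //; exact: measurable_tnth.
  by apply.
move=> t _ /=; apply/cvgrPdist_lt => e e0.
have /cvgrPdist_lt /(_ e e0) /nbhs_ballP [r /= r0 hr] := cf (row_of_tuple t).
near=> n; apply: hr; split => // i j; rewrite !mxE tnth_mktuple.
have n0 : 0 < n.+1%:R :> R by rewrite ltr0n.
have /andP[h1 h2] := floor_itv (n.+1%:R * tnth t j).
rewrite /ball /= -(ltr_pM2l n0) -[X in X * `|_|](ger0_norm (ltW n0)) -normrM.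
rewrite mulrBr [_ * (_ / _)]mulrC divfK ?gt_eqF// ger0_norm ?subr_ge0//.
apply: (@lt_le_trans _ _ 1); first by move: h2; rewrite intrD; lra.
rewrite -ler_pdivrMr// mul1r; near: n.
have := near_infty_natSinv_lt (PosNum r0); apply: filterS => k /= /ltW kr.
by rewrite -[leRHS]invrK lef_pV2 ?posrE ?invr_gt0.
Unshelve. all: by end_near.
Qed.

End lebesgue_vectors.

(** * Gaussian integrals and unit cubes *)

Section gaussian_integrals.
Context {R : realType} {d : nat}.
Notation vec := 'rV[R]_d.
Notation mu := (@lebesgue_measure R).

Lemma enorm_sqr_sum (x : vec) : enorm x ^+ 2 = \sum_(i < d) x 0 i ^+ 2.
Proof. by rewrite enorm_sqr; apply: eq_bigr => i _; rewrite expr2. Qed.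

Lemma leb_int_prod (F : 'I_d -> R -> R) : (forall i x, 0 <= F i x) ->
  (forall i, measurable_fun setT (F i)) ->
  leb_int (fun x : vec => (\prod_(i < d) F i (x 0 i))%:E) =
  (\prod_(i < d) \int[mu]_t (F i t)%:E)%E.
Proof.
move=> F0 mF.
(* [iint_prod] takes a family indexed by all naturals; indices from [d] on get the constant 1. *)
pose F' k := if insub k is Some i then F i else fun=> 1.
have F'E (i : 'I_d) : F' i = F i by rewrite /F' valK.
under [RHS]eq_bigr do rewrite -F'E.
rewrite -iint_prod.
- apply: eq_iint => s _; congr EFin; apply: eq_bigr => i _.
  by rewrite F'E mxE.
- by move=> k x; rewrite /F'; case: insubP.
- by move=> k; rewrite /F'; case: insubP.
Qed.

Lemma integral_gauss (c b : R) : 0 < c ->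
  (\int[mu]_t (expR (- (c * (t - b) ^+ 2)))%:E = (Num.sqrt (pi / c))%:E)%E.
Proof.
(* With standard deviation [s] the normal density is proportional to the integrand. *)
move=> c0; pose s := Num.sqrt ((2 * c)^-1).
have c20 : 0 < (2 * c)^-1 by rewrite invr_gt0 mulr_gt0.
have s0 : s != 0 by rewrite gt_eqF// sqrtr_gt0.
have s2 : s ^+ 2 = (2 * c)^-1 by rewrite sqr_sqrtr// ltW.
have E t : expR (- (c * (t - b) ^+ 2)) = Num.sqrt (pi / c) * normal_pdf b s t.
  rewrite normal_pdfE// /normal_peak /normal_fun s2.
  have -> : (2 * c)^-1 * pi *+ 2 = pi / c by field; rewrite gt_eqF.
  rewrite mulVKf; last by rewrite gt_eqF// sqrtr_gt0 divr_gt0// pi_gt0.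
  by congr expR; field; rewrite gt_eqF.
under eq_integral do rewrite E EFinM.
rewrite ge0_integralZl_EFin//.
- by rewrite integral_normal_pdf mule1.
- by move=> t _; rewrite lee_fin normal_pdf_ge0.
- by apply/measurable_EFinP; exact: measurable_normal_pdf.
Qed.

Lemma leb_int_gauss (c : R) (b : vec) : 0 < c ->
  leb_int (fun y => (expR (- (c * enorm (y - b) ^+ 2)))%:E) =
  (Num.sqrt (pi / c) ^+ d)%:E.
Proof.
move=> c0; transitivity (leb_int (fun y : vec =>
    (\prod_(i < d) expR (- (c * (y 0 i - b 0 i) ^+ 2)))%:E)).
  apply: eq_leb_int => y; congr EFin.
  rewrite -expR_sum sumrN -mulr_sumr enorm_sqr_sum.
  by congr (expR (- (_ * _))); apply: eq_bigr => i _; rewrite !mxE.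
rewrite (leb_int_prod (F := fun i t => expR (- (c * (t - b 0 i) ^+ 2)))).
- under eq_bigr do rewrite integral_gauss//.
  by rewrite prodEFin prodr_const card_ord.
- by move=> i x; exact: expR_ge0.
- move=> i; apply: measurableT_comp => //; apply: measurableT_comp => //.
  apply: measurable_funM => //; apply: measurable_funX.
  exact: measurable_funB.
Qed.

Lemma meas_gauss (c : R) (b : vec) : meas_fun (fun y => expR (- (c * enorm (y - b) ^+ 2))).
Proof.
rewrite /meas_fun /comp; apply: measurableT_comp => //; apply: measurableT_comp => //.
apply: measurable_funM => //.
under eq_fun do rewrite enorm_sqr_sum.
apply: measurable_sum => i; apply: measurable_funX.
under eq_fun do rewrite !mxE.
by apply: measurable_funB => //; exact: measurable_tnth.
Qed.

(** Gaussian domination gives every explicit upper bound needed: for [V] against the proposal and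
    against [expR (- U x)]. *)
Lemma leb_int_le_gauss (h : vec -> R) (c a : R) (b : vec) : meas_fun h ->
  (forall y, 0 <= h y) -> 0 <= a -> 0 < c ->
  (forall y, h y <= a * expR (- (c * enorm (y - b) ^+ 2))) ->
  (leb_int (fun y => (h y)%:E) <= (a * Num.sqrt (pi / c) ^+ d)%:E)%E.
Proof.
move=> mh h0 a0 c0 hle.
have me : emeas_fun (fun y : vec => (expR (- (c * enorm (y - b) ^+ 2)))%:E).
  by apply/(@meas_fun_EFin R d); exact: meas_gauss.
rewrite EFinM -(leb_int_gauss b c0) -leb_intZl//.
apply: le_leb_int.
- by move=> y; rewrite lee_fin.
- by move=> y; rewrite -EFinM lee_fin.
- exact/(@meas_fun_EFin R d).
- by rewrite /emeas_fun /comp; apply: measurable_funeM; exact: me.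
Qed.

(** Indicator of the unit cube with lower corner [b], as a product so that its integral factors. *)
Definition unit_box (b y : vec) : R := \prod_(i < d) \1_`[b 0 i, b 0 i + 1] (y 0 i).

Lemma unit_box_ge0 b y : 0 <= unit_box b y.
Proof. by apply: prodr_ge0 => i _. Qed.

Lemma unit_box_le1 b y : unit_box b y <= 1.
Proof. by apply: prodr_ile1 => i _; rewrite indicE; case: (_ \in _); rewrite ?lexx ?ler01. Qed.

Lemma unit_box_neq0 b y : unit_box b y != 0 -> enorm (y - b) <= Num.sqrt d%:R.
Proof.
move=> /prodf_neq0 h.
rewrite ler_wsqrtr// -enorm_sqr enorm_sqr_sum.
have -> : d%:R = \sum_(i < d) 1 :> R by rewrite sumr_const card_ord.
apply: ler_sum => i _; have := h i isT.
rewrite indicE pnatr_eq0 eqb0 negbK inE /= in_itv /= !mxE => /andP[h1 h2].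
by rewrite expr_le1// ?subr_ge0//; lra.
Qed.

Lemma meas_unit_box b : meas_fun (unit_box b).
Proof.
rewrite /meas_fun /unit_box /comp; apply: measurable_prod => i _ /=.
under eq_fun do rewrite mxE.
have mI : measurable_fun [set: R] (\1_`[b 0 i, b 0 i + 1] : R -> R).
  by apply: measurable_indic.
exact: (measurableT_comp mI (measurable_tnth i)).
Qed.

Lemma leb_int_unit_box b : leb_int (fun y => (unit_box b y)%:E) = 1%E.
Proof.
rewrite (leb_int_prod (F := fun i t => \1_`[b 0 i, b 0 i + 1] t))//; last first.
  by move=> i; apply: measurable_indic.
apply: big1 => i _; rewrite integral_indic// setIT /= lebesgue_measure_itv /=.
by rewrite lte_fin ltrDl ltr01 -EFinD addrAC subrr add0r.
Qed.

End gaussian_integrals.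

(** * Harris' theorem on a cone of nonnegative functions *)

Section harris.
Context {R : realType} {T : Type}.
Implicit Types (f g V : T -> R) (D : set (T -> R)).

Record function_cone D := FunctionCone {
  cone_ge0 : forall f, D f -> forall x, 0 <= f x;
  cone_cst : forall c, 0 <= c -> D (fun=> c);
  coneD : forall f g, D f -> D g -> D (fun x => f x + g x);
  coneZ : forall c f, 0 <= c -> D f -> D (fun x => c * f x);
  coneB : forall f g, D f -> D g -> (forall x, f x <= g x) ->
    D (fun x => g x - f x) }.

(** Abstract form of integration against a finite measure, with finite additivity only. *)
Record cone_functional D (l : (T -> R) -> R) := ConeFunctional {
  functional_ge0 : forall f, D f -> 0 <= l f;
  functionalD : forall f g, D f -> D g -> l (fun x => f x + g x) = l f + l g;
  functionalZ : forall c f, 0 <= c -> D f -> l (fun x => c * f x) = c * l f }.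

Lemma le_functional D l f g : function_cone D -> cone_functional D l ->
  D f -> D g -> (forall x, f x <= g x) -> l f <= l g.
Proof.
move=> DC lD Df Dg fg.
have -> : g = (fun x => f x + (g x - f x)).
  by apply/funext => x; rewrite addrC subrK.
rewrite (functionalD lD)//; last exact: (coneB DC).
by rewrite lerDl (functional_ge0 lD)//; exact: (coneB DC).
Qed.

Lemma functional_affine D l V a e : function_cone D -> cone_functional D l -> D V ->
  0 <= a -> 0 <= e -> l (fun x => a + e * V x) = a * l (fun=> 1) + e * l V.
Proof.
move=> DC lD DV a0 e0.
rewrite (functionalD lD); [|exact: (cone_cst DC)|exact: (coneZ DC)].
rewrite (functionalZ lD)//; congr (_ + _).
rewrite -(functionalZ lD)//; last exact: (cone_cst DC).
by congr l; apply/funext => x; rewrite mulr1.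
Qed.

(** [f - c] may leave the cone, so the two-sided bound is rewritten as two inequalities between
    nonnegative functions, [f <= (c + a) + e V] and [c <= f + a + e V]. *)
Lemma functional_band D l f V c a e : function_cone D -> cone_functional D l ->
  D f -> D V -> 0 <= c -> 0 <= a -> 0 <= e ->
  (forall x, `|f x - c| <= a + e * V x) ->
  l f <= (c + a) * l (fun=> 1) + e * l V /\
  c * l (fun=> 1) <= l f + a * l (fun=> 1) + e * l V.
Proof.
move=> DC lD Df DV c0 a0 e0 fc.
have DaV b : 0 <= b -> D (fun x => b + e * V x).
  by move=> b0; apply: (coneD DC); [exact: (cone_cst DC)|exact: (coneZ DC)].
split.
  rewrite -(functional_affine DC lD) ?addr_ge0//.
  apply: (le_functional DC lD) => //; first by apply: DaV; exact: addr_ge0.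
  by move=> x; have := fc x; rewrite ler_norml => /andP[_]; lra.
rewrite -addrA -(functional_affine DC lD)// -(functionalD lD)//; last exact: DaV.
rewrite -(functionalZ lD)//; last exact: (cone_cst DC).
apply: (le_functional DC lD).
- by apply: (coneZ DC) => //; exact: (cone_cst DC).
- by apply: (coneD DC) => //; exact: DaV.
- by move=> x; have := fc x; rewrite ler_norml => /andP[]; lra.
Qed.

(** The supremum of [g - w] lies below every value of [g + w], so it is a centre. Raising it to 0 if
    negative is harmless, since [g + w] is nonnegative. *)
Lemma exists_center (g w : T -> R) (x0 : T) : (forall x, 0 <= g x) -> (forall x, 0 <= w x) ->
  (forall x y, g x - g y <= w x + w y) ->
  exists2 c, 0 <= c & forall x, `|g x - c| <= w x.
Proof.
move=> g0 w0 gw; pose E := range (fun x => g x - w x).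
have Eub y : ubound E (g y + w y) by move=> _ [x _ <-]; have := gw x y; lra.
have Esup : has_sup E.
  by split; [exists (g x0 - w x0); exists x0 | exists (g x0 + w x0)].
exists (Num.max 0 (sup E)); first by rewrite le_max lexx.
move=> x; rewrite ler_norml.
have h1 : g x - w x <= sup E by apply: ub_le_sup; [exact: Esup.2 | exists x].
have h2 : sup E <= g x + w x by apply: ge_sup; [exact: Esup.1 | exact: Eub].
have gx := g0 x; have wx := w0 x.
by case: (leP 0 (sup E)) => ?; apply/andP; split; lra.
Qed.

Variables (D : set (T -> R)) (P : (T -> R) -> T -> R) (V : T -> R) (lam b : R).
Hypothesis DC : function_cone D.
Hypothesis Pfun : forall x, cone_functional D (P ^~ x).
Hypothesis PD : forall f, D f -> D (P f).
Hypothesis P1 : forall x, P (fun=> 1) x = 1.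
Hypothesis DV : D V.
Hypothesis V1 : forall x, 1 <= V x.
Hypothesis lam0 : 0 <= lam.
Hypothesis lam1 : lam < 1.
Hypothesis b0 : 0 <= b.
Hypothesis drift : forall x, P V x <= lam * V x + b.
Hypothesis minorization : forall r : R, exists (eps : R) (nu : (T -> R) -> R),
  [/\ 0 < eps, cone_functional D nu, nu (fun=> 1) = 1 &
      forall f x, D f -> V x <= r -> eps * nu f <= P f x].

(* Hairer and Mattingly's contraction in the seminorm weighted by 1 + beta V. *)
Lemma harris_contraction (x0 : T) : exists beta alpha : R,
  [/\ 0 < beta, 0 <= alpha, alpha < 1 &
   forall f c A, D f -> 0 <= c -> 0 <= A ->
     (forall x, `|f x - c| <= A * (1 + beta * V x)) ->
     exists2 c', 0 <= c' & forall x, `|P f x - c'| <= alpha * A * (1 + beta * V x)].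
Proof.
(* Once [V x + V y >= r], the total drift constant [2 * b] uses at most half of the gain
   [(1 - lam) (V x + V y)]. *)
pose r := 4 * b / (1 - lam) + 1.
have l1 : 0 < 1 - lam by rewrite subr_gt0.
have r0 : 0 < r by rewrite ltr_wpDl// divr_ge0 ?mulr_ge0// ltW.
have rb : 4 * b <= (1 - lam) * r.
  by rewrite /r mulrDr mulr1 [(1 - lam) * (_ / _)]mulrC divfK ?gt_eqF// lerDl ltW.
have [eps [nu [eps0 nuD nu1 minor]]] := minorization r.
(* Chosen so that the drift constant, weighted by [beta], costs at most [eps] of the [2 * eps]
   gained by minorization; [b + 1] keeps the denominator positive. *)
pose beta := eps / (2 * (b + 1)).
have beta0 : 0 < beta by rewrite divr_gt0// mulr_gt0// ltr_wpDl.
have betab : 2 * (beta * b) <= eps.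
  have -> : eps = 2 * (beta * (b + 1)) by rewrite /beta; field; rewrite gt_eqF// ltr_wpDl.
  by rewrite ler_pM2l// ler_pM2l// lerDl.
(* The relative gain [beta (1 - lam) / 2 * S / (2 + beta S)] increases with [S]; [t] is its value at
   [S = r]. *)
pose t := beta * ((1 - lam) / 2) * r / (2 + beta * r).
have br0 : 0 < beta * r by exact: mulr_gt0.
have tE : t * (2 + beta * r) = beta * ((1 - lam) / 2) * r.
  by rewrite /t divfK// gt_eqF//; lra.
have t0 : 0 < t.
  apply: divr_gt0; last by rewrite addr_gt0.
  by apply: mulr_gt0 => //; apply: mulr_gt0 => //; apply: divr_gt0.
(* The first two entries serve the constant part and the [V] part when [V x + V y < r]; the last
   serves the opposite case. *)
pose alpha := Num.max (Num.max (1 - eps / 2) lam) (1 - t).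
have a1 : 1 - eps / 2 <= alpha by rewrite !le_max lexx.
have a2 : lam <= alpha by rewrite !le_max lexx orbT.
have a3 : 1 - t <= alpha by rewrite !le_max lexx orbT.
have alt1 : alpha < 1 by rewrite !gt_max lam1; apply/andP; split; lra.
have alpha0 : 0 <= alpha by exact: le_trans a2.
exists beta, alpha; split => // f c A Df c0 A0 fc.
apply: exists_center => //.
- by move=> x; apply: (cone_ge0 DC); exact: PD.
- by move=> x; rewrite !mulr_ge0// addr_ge0// mulr_ge0 ?ltW// (lt_le_trans ltr01).
move=> x y.
have V0 z : 0 <= V z by rewrite (le_trans ler01).
have fc' z : `|f z - c| <= A + A * beta * V z.
  by rewrite (le_trans (fc z))// mulrDr mulr1 mulrA.
have Ab0 : 0 <= A * beta by rewrite mulr_ge0// ltW.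
rewrite -mulrDr.
suff : P f x - P f y <= A * (alpha * (2 + beta * (V x + V y))).
  by move=> /le_trans; apply; lra.
have [rS|Sr] := leP r (V x + V y).
  have [h1 _] := functional_band DC (Pfun x) Df DV c0 A0 Ab0 fc'.
  have [_ h2] := functional_band DC (Pfun y) Df DV c0 A0 Ab0 fc'.
  rewrite P1 mulr1 in h1; rewrite P1 !mulr1 in h2.
  have h : P f x - P f y <= A * (2 + beta * (P V x + P V y)) by lra.
  rewrite (le_trans h)// ler_wpM2l//.
  have hd : P V x + P V y <= (V x + V y) - (1 - lam) / 2 * (V x + V y).
    have := drift x; have := drift y.
    have : (1 - lam) * r <= (1 - lam) * (V x + V y) by rewrite ler_wpM2l// ltW.
    by lra.
  have hb : beta * (P V x + P V y) <=
      beta * ((V x + V y) - (1 - lam) / 2 * (V x + V y)) by rewrite ler_wpM2l// ltW.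
  have h3 : t * (2 + beta * (V x + V y)) <= beta * ((1 - lam) / 2) * (V x + V y).
    have tr : t * r <= t * (V x + V y) by rewrite ler_wpM2l// ltW.
    have : t * (2 + beta * r) * (V x + V y) >= t * (2 + beta * (V x + V y)) * r by nra.
    rewrite tE => h4.
    rewrite -(ler_pM2r r0) (le_trans h4)//.
    by rewrite mulrAC.
  have : (1 - t) * (2 + beta * (V x + V y)) <= alpha * (2 + beta * (V x + V y)).
    by rewrite ler_wpM2r// addr_ge0// mulr_ge0 ?addr_ge0// ltW.
  by lra.
have Vxr : V x <= r by have := V0 y; lra.
have Vyr : V y <= r by have := V0 x; lra.
(* The common part [eps * nu] cancels in [P f x - P f y]; the remainder [Q] is still a positive
   functional where [V z <= r], of mass [1 - eps]. *)
pose Q z g := P g z - eps * nu g.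
have Qfun z : V z <= r -> cone_functional D (Q z).
  move=> Vz; split.
  - by move=> g Dg; rewrite subr_ge0 minor.
  - by move=> g h Dg Dh; rewrite /Q (functionalD (Pfun z))// (functionalD nuD)//; lra.
  - by move=> e g e0 Dg; rewrite /Q (functionalZ (Pfun z))// (functionalZ nuD)//; lra.
have [h1 _] := functional_band DC (Qfun x Vxr) Df DV c0 A0 Ab0 fc'.
have [_ h2] := functional_band DC (Qfun y Vyr) Df DV c0 A0 Ab0 fc'.
have Q1 z : Q z (fun=> 1) = 1 - eps by rewrite /Q P1 nu1 mulr1.
rewrite Q1 in h1; rewrite Q1 in h2.
have QV z : Q z V <= P V z.
  by rewrite lerBlDr lerDl mulr_ge0 ?(ltW eps0)// (functional_ge0 nuD).
have h : P f x - P f y <= A * (2 * (1 - eps) + beta * (P V x + P V y)).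
  have e1 : P f x - P f y = Q x f - Q y f by rewrite /Q; lra.
  have e2 : A * beta * Q x V <= A * beta * P V x by rewrite ler_wpM2l.
  have e3 : A * beta * Q y V <= A * beta * P V y by rewrite ler_wpM2l.
  by rewrite e1; lra.
rewrite (le_trans h)// ler_wpM2l//.
have hb : beta * (P V x + P V y) <= beta * (lam * (V x + V y) + 2 * b).
  by rewrite ler_wpM2l ?(ltW beta0)//; have := drift x; have := drift y; lra.
have hS : lam * (beta * (V x + V y)) <= alpha * (beta * (V x + V y)).
  by rewrite ler_wpM2r// mulr_ge0 ?addr_ge0// ltW.
by lra.
Qed.

Variable Pi : (T -> R) -> R.
Hypothesis Pifun : cone_functional D Pi.
Hypothesis Pi1 : Pi (fun=> 1) = 1.
Hypothesis PiP : forall f, D f -> Pi (P f) = Pi f.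

(** Iterating the contraction puts [iter k P f] close to some constant [c]. Integrating against the
    invariant [Pi] shows that [c] is close to [Pi f], and the two estimates add up. *)
Theorem harris (x0 : T) : exists C rho : R, [/\ 0 <= C, 0 <= rho, rho < 1 &
  forall f, D f -> (forall x, f x <= V x) ->
  forall k x, `|iter k P f x - Pi f| <= C * rho ^+ k * V x].
Proof.
have [beta [alpha [be0 al0 al1 step]]] := harris_contraction x0.
have PiV0 : 0 <= Pi V by exact: (functional_ge0 Pifun).
exists (2 / beta + 1 + Pi V), alpha; split => //.
  by rewrite !addr_ge0// divr_ge0// ltW.
move=> f Df fV k.
have DPk j : D (iter j P f) by elim: j => //= j; exact: PD.
have PiPk j : Pi (iter j P f) = Pi f by elim: j => //= j IH; rewrite PiP.
have V0 z : 0 <= V z by rewrite (le_trans ler01).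
have [c c0 hc] : exists2 c, 0 <= c & forall x,
    `|iter k P f x - c| <= alpha ^+ k / beta * (1 + beta * V x).
  elim: k => [|k [c c0 IH]].
    (* Since [0 <= f <= V], the induction starts with centre 0 and amplitude [1 / beta]. *)
    exists 0 => // x; rewrite subr0 ger0_norm ?(cone_ge0 DC)//= expr0 mul1r.
    rewrite (le_trans (fV x))// mulrDr mulr1 mulKf ?gt_eqF//.
    by rewrite lerDr invr_ge0 ltW.
  have [|c' c'0 hc'] := step _ _ _ (DPk k) c0 _ IH.
    by rewrite divr_ge0 ?exprn_ge0// ltW.
  by exists c' => // x; rewrite exprS -[alpha * _ / _]mulrA; exact: hc'.
have ak0 : 0 <= alpha ^+ k / beta by rewrite divr_ge0 ?exprn_ge0// ltW.
have hc' z : `|iter k P f z - c| <= alpha ^+ k / beta + alpha ^+ k * V z.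
  have -> : alpha ^+ k * V z = alpha ^+ k / beta * (beta * V z).
    by rewrite mulrA divfK// gt_eqF.
  by have := hc z; rewrite mulrDr mulr1.
have [h1 h2] := functional_band DC Pifun (DPk k) DV c0 ak0 (exprn_ge0 k al0) hc'.
move: h1 h2; rewrite PiPk Pi1 !mulr1 => h1 h2 x.
have Vx := V1 x.
have -> : (2 / beta + 1 + Pi V) * alpha ^+ k * V x =
   2 * (alpha ^+ k / beta * V x) + alpha ^+ k * V x + alpha ^+ k * Pi V * V x by ring.
have g1 : alpha ^+ k / beta <= alpha ^+ k / beta * V x by rewrite ler_peMr.
have g2 : alpha ^+ k * Pi V <= alpha ^+ k * Pi V * V x.
  by rewrite ler_peMr// mulr_ge0// exprn_ge0.
by have := hc' x; rewrite !ler_norml => /andP[? ?]; apply/andP; split; lra.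
Qed.

End harris.

(** * Integration against densities for functions dominated by [V] *)

Section weighted_functionals.
Context {R : realType} {d : nat}.
Notation vec := 'rV[R]_d.
Variable V : vec -> R.
Hypothesis mV : meas_fun V.
Hypothesis V1 : forall x, 1 <= V x.
Implicit Types (f w : vec -> R).

Definition Vcone : set (vec -> R) :=
  [set f | [/\ meas_fun f, forall x, 0 <= f x & exists C, forall x, f x <= C * V x]].

Let V0 x : 0 <= V x. Proof. exact: le_trans (V1 x). Qed.

Lemma Vcone_cone : function_cone Vcone.
Proof.
split.
- by move=> f [].
- move=> c c0; split => //; first exact: measurable_cst.
  by exists c => x; rewrite ler_peMr.
- move=> f h [mf f0 [A fA]] [mh h0 [B hB]]; split.
  + exact: measurable_funD.
  + by move=> x; rewrite addr_ge0.
  + by exists (A + B) => x; rewrite mulrDl lerD.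
- move=> c f c0 [mf f0 [A fA]]; split.
  + exact: measurable_funM.
  + by move=> x; rewrite mulr_ge0.
  + by exists (c * A) => x; rewrite -mulrA ler_wpM2l.
- move=> f h [mf f0 [A fA]] [mh h0 [B hB]] fh; split.
  + exact: measurable_funB.
  + by move=> x; rewrite subr_ge0.
  + by exists B => x; rewrite (le_trans _ (hB x))// lerBlDr lerDl.
Qed.

Lemma Vcone_V : Vcone V.
Proof. by split => //; exists 1 => x; rewrite mul1r. Qed.

(** Integrability of [V] against [w] makes the integral of every function of [Vcone] finite, so that
    [wint] may be real-valued. *)
Definition weight w :=
  [/\ meas_fun w, forall x, 0 <= w x & (leb_int (fun y => (V y * w y)%:E) < +oo)%E].

Definition wint w f : R := fine (leb_int (fun y => (f y * w y)%:E)).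

Let emeas_mul f w : meas_fun f -> meas_fun w -> emeas_fun (fun y => (f y * w y)%:E).
Proof. by move=> mf mw; apply/meas_fun_EFin; exact: measurable_funM. Qed.

(** [fine] loses nothing here: the integrand is dominated by [|C| V w], whose integral is finite. *)
Lemma wintE w f : weight w -> Vcone f ->
  leb_int (fun y => (f y * w y)%:E) = (wint w f)%:E.
Proof.
move=> [mw w0 Vw] [mf f0 [C fC]]; rewrite /wint fineK//.
rewrite ge0_fin_numE; last first.
  by apply: leb_int_ge0 => y; rewrite lee_fin mulr_ge0.
apply: (@le_lt_trans _ _ (leb_int (fun y => (`|C|%:E * (V y * w y)%:E)%E))).
  apply: le_leb_int; last 2 first.
  - exact: emeas_mul.
  - by rewrite /emeas_fun /comp; apply: measurable_funeM; exact: emeas_mul.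
  - by move=> x; rewrite lee_fin mulr_ge0.
  - move=> x; rewrite -EFinM lee_fin mulrA ler_wpM2r//.
    by rewrite (le_trans (fC x))// ler_wpM2r// ler_norm.
rewrite leb_intZl//; last exact: emeas_mul.
  by rewrite lte_mul_pinfty// lee_fin.
by move=> x; rewrite lee_fin mulr_ge0.
Qed.

Lemma wint_functional w : weight w -> cone_functional Vcone (wint w).
Proof.
move=> Ww; have [mw w0 Vw] := Ww; split.
- move=> f [mf f0 _]; apply: fine_ge0; apply: leb_int_ge0 => y.
  by rewrite lee_fin mulr_ge0.
- move=> f h Df Dh; apply: EFin_inj; rewrite EFinD -!wintE//; last exact: coneD Vcone_cone _ _ _ _.
  have [mf f0 _] := Df; have [mh h0 _] := Dh.
  rewrite -leb_intD.
  + by apply: eq_leb_int => y; rewrite -EFinD mulrDl.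
  + by move=> y; rewrite lee_fin mulr_ge0.
  + by move=> y; rewrite lee_fin mulr_ge0.
  + exact: emeas_mul.
  + exact: emeas_mul.
- move=> c f c0 Df; apply: EFin_inj; rewrite EFinM -!wintE//; last exact: coneZ Vcone_cone _ _ _ _.
  have [mf f0 _] := Df.
  rewrite -leb_intZl//.
  + by apply: eq_leb_int => y; rewrite -EFinM mulrA.
  + by move=> y; rewrite lee_fin mulr_ge0.
  + exact: emeas_mul.
Qed.

Lemma le_weight w w' (c : R) : meas_fun w -> (forall x, 0 <= w x) -> 0 <= c -> weight w' ->
  (forall x, w x <= c * w' x) -> weight w.
Proof.
move=> mw w0 c0 [mw' w'0 Vw'] ww'; split => //.
apply: (@le_lt_trans _ _ (leb_int (fun y => (c%:E * (V y * w' y)%:E)%E))).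
  apply: le_leb_int; last 2 first.
  - exact: emeas_mul.
  - by rewrite /emeas_fun /comp; apply: measurable_funeM; exact: emeas_mul.
  - by move=> x; rewrite lee_fin mulr_ge0.
  - by move=> x; rewrite -EFinM lee_fin mulrCA ler_wpM2l.
rewrite leb_intZl//; last exact: emeas_mul.
  by rewrite lte_mul_pinfty// lee_fin.
by move=> x; rewrite lee_fin mulr_ge0.
Qed.

Lemma le_wint w w' f : weight w -> weight w' -> Vcone f ->
  (forall x, w x <= w' x) -> wint w f <= wint w' f.
Proof.
move=> Ww Ww' Df ww'; rewrite -lee_fin -!wintE//.
have [mf f0 _] := Df; have [mw w0 _] := Ww; have [mw' w'0 _] := Ww'.
apply: le_leb_int; last 2 first.
- exact: emeas_mul.
- exact: emeas_mul.
- by move=> x; rewrite lee_fin mulr_ge0.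
- by move=> x; rewrite lee_fin ler_wpM2l.
Qed.

Lemma wintZ w f c : weight w -> Vcone f -> 0 <= c ->
  wint (fun y => c * w y) f = c * wint w f.
Proof.
move=> Ww Df c0; have [mf f0 _] := Df; have [mw w0 _] := Ww.
rewrite /wint; under eq_leb_int do rewrite mulrCA EFinM.
rewrite leb_intZl//; last exact: emeas_mul.
  by rewrite wintE.
by move=> y; rewrite lee_fin mulr_ge0.
Qed.

End weighted_functionals.

(** * Proposal density, density of accepted moves, detailed balance *)

Section mala_kernel.
Context {R : realType} {d : nat}.
Notation vec := 'rV[R]_d.
Variables (U : vec -> R) (g : R).
Hypothesis UC2 : C2 U.
Hypothesis g0 : 0 < g.

Let normalizer : R := powR (4 * pi * g) (- (d%:R / 2)).

Let pig0 : 0 < 4 * pi * g. Proof. by rewrite !mulr_gt0// pi_gt0. Qed.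

Lemma prop_dens_normalizer_gt0 : 0 < normalizer.
Proof. exact: powR_gt0. Qed.

(** Displays the proposal as a Gaussian centred at the Euler step, the form used for integration and
    measurability. *)
Lemma prop_densE x y : prop_dens U g x y =
  normalizer * expR (- ((4 * g)^-1 * enorm (y - (x - g *: grad U x)) ^+ 2)).
Proof.
have -> : y - (x - g *: grad U x) = y - x + g *: grad U x by rewrite opprB addrA addrAC.
by rewrite /prop_dens mulNr [_^-1 * _]mulrC.
Qed.

Lemma prop_dens_gt0 x y : 0 < prop_dens U g x y.
Proof. by rewrite /prop_dens mulr_gt0 ?expR_gt0// prop_dens_normalizer_gt0. Qed.

Lemma leb_int_prop_dens x : leb_int (fun y => (prop_dens U g x y)%:E) = 1%E.
Proof.
have g40 : 0 < (4 * g)^-1 by rewrite invr_gt0 mulr_gt0.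
under eq_leb_int do rewrite prop_densE EFinM.
rewrite leb_intZl; last 3 first.
- exact/ltW/prop_dens_normalizer_gt0.
- by move=> y; rewrite lee_fin expR_ge0.
- by apply/(@meas_fun_EFin R d); exact: meas_gauss.
rewrite leb_int_gauss// invrK mulrA [pi * 4]mulrC -EFinM; congr EFin.
rewrite /normalizer powRN -powR12_sqrt ?ltW// -powR_mulrn ?powR_ge0//.
by rewrite -powRrM [2^-1 * _]mulrC mulVf// gt_eqF// powR_gt0.
Qed.

Let mU : meas_fun U.
Proof. by apply: continuous_meas_fun => x; apply: differentiable_continuous; exact: UC2.1. Qed.

Let mgrad i : meas_fun (fun x => grad U x 0 i).
Proof.
apply: continuous_meas_fun; rewrite (_ : (fun _ => _) = 'D_(evec R i) U); last first.
  by apply/funext => x; rewrite mxE.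
by move=> x; apply: differentiable_continuous; exact: UC2.2.1.
Qed.

Lemma meas_fun2_prop_dens : meas_fun2 (prop_dens U g).
Proof.
rewrite /meas_fun2; under eq_fun do rewrite prop_densE.
apply: measurable_funM => //; apply: measurableT_comp => //.
apply: measurableT_comp => //; apply: measurable_funM => //.
under eq_fun do rewrite enorm_sqr_sum.
apply: measurable_sum => i; apply: measurable_funX.
under eq_fun do rewrite !mxE.
have mcoord : meas_fun (fun x : vec => x 0 i).
  by rewrite /meas_fun /comp; under eq_fun do rewrite mxE; exact: measurable_tnth.
apply: measurable_funB.
  by have := meas_fun2_snd mcoord; rewrite /meas_fun2; under eq_fun do rewrite mxE.
apply: measurable_funB.
  by have := meas_fun2_fst mcoord; rewrite /meas_fun2; under eq_fun do rewrite mxE.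
apply: measurable_funM => //.
by have := meas_fun2_fst (mgrad i); rewrite /meas_fun2; under eq_fun do rewrite mxE.
Qed.

(* The density of accepted moves [accept x y * prop_dens x y], in a form free of
   the normalizing constant. *)
Definition move_dens x y : R :=
  Num.min (prop_dens U g x y) (expR (U x - U y) * prop_dens U g y x).

Lemma move_dens_ge0 x y : 0 <= move_dens x y.
Proof.
by rewrite le_min ltW ?prop_dens_gt0//= mulr_ge0 ?expR_ge0// ltW ?prop_dens_gt0.
Qed.

Lemma move_dens_le x y : move_dens x y <= prop_dens U g x y.
Proof. by rewrite ge_min lexx. Qed.

Lemma meas_fun2_move_dens : meas_fun2 move_dens.
Proof.
apply: measurable_minr; first exact: meas_fun2_prop_dens.
apply: measurable_funM; last exact: meas_fun2_swap meas_fun2_prop_dens.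
apply: measurableT_comp => //; apply: measurable_funB.
  exact: meas_fun2_fst.
exact: meas_fun2_snd.
Qed.

Lemma accept_prop_dens x y : 0 < Zconst U ->
  accept U g x y * prop_dens U g x y = move_dens x y.
Proof.
rewrite /accept /move_dens /dens expRD !expRN.
move: (prop_dens_gt0 x y) (prop_dens_gt0 y x) (expR_gt0 (U x)) (expR_gt0 (U y)).
move: (prop_dens U g x y) (prop_dens U g y x) (expR (U x)) (expR (U y)) => r r' ex ey.
move: (Zconst U) => Z r0 r'0 ex0 ey0 Z0.
rewrite minr_pMl ?(ltW r0)// mul1r; congr (Num.min _ _).
by field; rewrite !gt_eqF.
Qed.

(** Detailed balance: both sides are the minimum of [prop_dens x y * expR (- U x)] and
    [prop_dens y x * expR (- U y)], divided by [Zconst U]. *)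
Lemma move_dens_reversible x y :
  move_dens x y * dens U x = move_dens y x * dens U y.
Proof.
rewrite /move_dens /dens.
move: (prop_dens U g x y) (prop_dens U g y x) (Zconst U)^-1 => r r' z.
rewrite !mulrA; congr (_ * z).
rewrite !minr_pMl ?expR_ge0// minC; congr (Num.min _ _).
  by rewrite mulrAC -expRD [X in expR X](_ : _ = - U y) 1?mulrC//; ring.
by rewrite [RHS]mulrAC -expRD [X in _ = expR X * _](_ : _ = - U x) 1?mulrC//; ring.
Qed.

End mala_kernel.

(** * Acceptance of moves far from the origin *)

Section mala_drift.
Context {R : realType} {d : nat}.
Notation vec := 'rV[R]_d.
Variables (U : vec -> R) (L m K g : R).
Hypothesis UC2 : C2 U.
Hypothesis grad0 : grad U 0 = 0.
Hypothesis L0 : 0 <= L.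
Hypothesis hessL : forall x y z, `|hess U x y z| <= L * enorm y * enorm z.
Hypothesis m0 : 0 < m.
Hypothesis K0 : 0 <= K.
Hypothesis hessm : forall x y, K <= enorm x -> enorm y = 1 -> m <= hess U x y y.
Hypothesis g0 : 0 < g.
Hypothesis gLL : g * L ^+ 2 <= m / 2.
Hypothesis gL : g * L <= 1 / 2.
Hypothesis gm : g * m <= 1.
Implicit Types x y : vec.

Notation B := ((m + L) * K).
Notation normalizer := (powR (4 * pi * g) (- (d%:R / 2))).

(** Forward minus reverse proposal exponent. The squares of [de] cancel, and the rest is arranged so
    that [- dotv de G] completes the convexity bracket while the other terms carry the gradient
    difference. *)
Lemma log_ratioE x y :
  let de := y - x in let a := grad U x in let G := grad U y in
  - enorm (de + g *: a) ^+ 2 / (4 * g) - - enorm (x - y + g *: G) ^+ 2 / (4 * g) =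
  - dotv de G + 2^-1 * dotv (G - a) (de + g *: a) + g / 4 * enorm (G - a) ^+ 2.
Proof.
move=> de a G.
have -> : x - y = - de by rewrite opprB.
clearbody de a G.
have -> : enorm (G - a) ^+ 2 = enorm G ^+ 2 - 2 * dotv G a + enorm a ^+ 2.
  by rewrite -scaleN1r enorm_lin_sqr; ring.
rewrite !enorm_lin_sqr enormN !dotvDr !dotvZr !dotvDl !dotvNl.
rewrite -(enorm_sqr a) (dotvC G de) (dotvC a de).
by move: (dotv de G) (dotv de a) (dotv G a) => *; field; rewrite gt_eqF.
Qed.

(** With [D = |y - x|], strong convexity contributes [- m D^2 / 2]; the two error terms are at most
    [m D^2 / 4], by the assumption on the Gaussian part, and [m D^2 / 8], by [gLL]. *)
Lemma move_densE_accepted x y :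
  (forall t : R, 0 <= t <= 1 -> K <= enorm (x + t *: (y - x))) ->
  2 * L * enorm (y - x + g *: grad U x) <= m * enorm (y - x) ->
  move_dens U g x y = prop_dens U g x y.
Proof.
move=> Kseg hw; rewrite /move_dens; apply/min_idPl.
rewrite /prop_dens mulrCA ler_pM2l ?powR_gt0 ?mulr_gt0 ?pi_gt0// -expRD ler_expR.
have conv := segment_strong_convexity UC2 hessL hessm Kseg.
rewrite [x + (y - x)]addrC subrK in conv.
have := log_ratioE x y; move: conv hw; set de := y - x; set w := _ + g *: grad U x => conv hw /=.
have lip := grad_lipschitz UC2 L0 hessL x y; rewrite -/de in lip.
have := cauchy_schwarz_dotv (grad U y - grad U x) w.
rewrite ler_norml => /andP[_] cs.
have D0 := enorm_ge0 de; have W0 := enorm_ge0 w.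
have G0 := enorm_ge0 (grad U y - grad U x).
move: conv cs lip hw D0 W0 G0.
move: (dotv de _) (dotv _ w) (enorm (grad U y - _)) => p q N.
move: (enorm de) (enorm w) => D W.
move: (- _ / (4 * g)) (- _ / (4 * g)) (U x) (U y) => n1 n2 u1 u2.
move=> conv cs lip hw D0 W0 N0 E.
have e1 : N * W <= L * D * W by rewrite ler_wpM2r.
have e2 : D * (2 * L * W) <= D * (m * D) by rewrite ler_wpM2l.
have e3 : N ^+ 2 <= (L * D) ^+ 2 by rewrite ler_sqr ?nnegrE// mulr_ge0.
have e4 : g * N ^+ 2 <= g * (L * D) ^+ 2 by rewrite ler_pM2l.
have e5 : g * L ^+ 2 * D ^+ 2 <= m / 2 * D ^+ 2 by rewrite ler_wpM2r ?sqr_ge0.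
have e6 : 0 <= m * D ^+ 2 by rewrite mulr_ge0 ?sqr_ge0// ltW.
rewrite !expr2 in e3 e4 e5 e6 conv E *; lra.
Qed.

Let pig0 : 0 < 4 * pi * g. Proof. by rewrite !mulr_gt0// pi_gt0. Qed.

Let B0 : 0 <= B. Proof. by rewrite mulr_ge0// addr_ge0// ltW. Qed.

Lemma grad_ge x : m * enorm x - B <= enorm (grad U x).
Proof.
have [x0|x0] := eqVneq (enorm x) 0.
  by rewrite x0 mulr0 add0r (le_trans _ (enorm_ge0 _))// oppr_le0.
have xp : 0 < enorm x by rewrite lt_neqAle eq_sym x0 enorm_ge0.
rewrite -(ler_pM2r xp); apply: le_trans (le_trans (ler_norm _) (cauchy_schwarz_dotv _ _)).
apply: le_trans (grad_radial UC2 grad0 L0 hessL m0 K0 hessm x).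
by rewrite expr2; lra.
Qed.

Lemma move_dens_ge_unit_box : exists2 rho, 0 <= rho & forall x y, rho <= enorm x ->
  unit_box (x - g *: grad U x) y != 0 ->
  normalizer * expR (- (d%:R / (4 * g))) <= move_dens U g x y.
Proof.
pose W : R := Num.sqrt d%:R.
have W0 : 0 <= W by exact: sqrtr_ge0.
have LWm : 0 <= 2 * L * W / m by rewrite divr_ge0 ?mulr_ge0// ltW.
(* In the cube the Gaussian part has norm at most [W]. The first summand keeps the segment outside
   radius [K], as the Euler displacement is at most [|x| / 2]; the second forces
   [|y - x| >= 2 L W / m]. *)
exists (2 * (K + W) + (B + (W + 2 * L * W / m) / g) / m).
  apply: addr_ge0; first by rewrite mulr_ge0// addr_ge0.
  by apply: divr_ge0 (ltW m0); apply: addr_ge0 => //; apply: divr_ge0 (ltW g0); apply: addr_ge0.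
move=> x y hx /unit_box_neq0; rewrite -/W.
have -> : y - (x - g *: grad U x) = y - x + g *: grad U x by rewrite opprB addrA addrAC.
set w := _ + g *: grad U x => wW.
have w0 := enorm_ge0 w.
have h1 : 2 * (K + W) <= enorm x.
  apply: le_trans hx; rewrite lerDl; apply: divr_ge0 (ltW m0).
  by apply: addr_ge0 => //; apply: divr_ge0 (ltW g0); apply: addr_ge0.
have h2 : W + 2 * L * W / m <= g * (m * enorm x - B).
  have : (B + (W + 2 * L * W / m) / g) / m <= enorm x.
    by apply: le_trans hx; rewrite lerDr mulr_ge0// addr_ge0.
  rewrite ler_pdivrMr// addrC -lerBrDr ler_pdivrMr//; lra.
have gE : g *: grad U x = w - (y - x) by rewrite /w addrC addKr.
have de_ge : g * enorm (grad U x) <= enorm w + enorm (y - x).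
  rewrite -{1}(ger0_norm (ltW g0)) -enormZ gE -(enormN (y - x)); exact: enormD.
have de_le : enorm (y - x) <= enorm w + g * enorm (grad U x).
  have -> : y - x = w + - (g *: grad U x) by rewrite /w addrK.
  apply: le_trans (enormD _ _) _.
  by rewrite enormN enormZ (ger0_norm (ltW g0)).
have gl := grad_le UC2 grad0 L0 hessL x.
have gge := grad_ge x.
have e1 : g * (m * enorm x - B) <= g * enorm (grad U x) by rewrite ler_pM2l.
have e2 : g * enorm (grad U x) <= g * L * enorm x by rewrite -mulrA ler_pM2l.
have e3 : g * L * enorm x <= 1 / 2 * enorm x by rewrite ler_wpM2r ?enorm_ge0.
rewrite move_densE_accepted.
- rewrite /prop_dens -/w ler_pM2l ?powR_gt0// ler_expR mulNr lerN2.
  rewrite ler_pM2r ?invr_gt0 ?mulr_gt0// -[leRHS](@sqr_sqrtr _ d%:R)//.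
  by rewrite ler_sqr ?nnegrE.
- move=> t /andP[t0 t1]; apply: le_trans (enormB_ge _ _).
  rewrite enormZ ger0_norm//.
  have : t * enorm (y - x) <= enorm (y - x) by rewrite ler_piMl ?enorm_ge0.
  by lra.
- rewrite -/w.
  have e4 : 2 * L * enorm w <= 2 * L * W by rewrite ler_wpM2l// mulr_ge0.
  apply: le_trans e4 _; rewrite [leRHS]mulrC -ler_pdivrMr//; lra.
Qed.

(** * The drift condition for [V] *)

Notation eta := (m / 16).
Notation V := (fun x : vec => expR (m / 16 * enorm x ^+ 2)).
Notation drift_exponent x :=
  (eta * enorm x ^+ 2 - eta * g * (m * enorm x ^+ 2 - 3 * B * enorm x)).

(** The factor [1 + g * m / 2] is room kept for the cross term between Euler step and noise in
    [V_prop_dens_le]. The contraction to [1 - 3/2 g m] is strong enough to leave [1 - g m] after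
    it. *)
Lemma euler_step_le x :
  (1 + g * m / 2) * enorm (x - g *: grad U x) ^+ 2 <=
  enorm x ^+ 2 - g * (m * enorm x ^+ 2 - 3 * B * enorm x).
Proof.
have -> : x - g *: grad U x = x + (- g) *: grad U x by rewrite scaleNr.
rewrite enorm_lin_sqr (dotvC x).
have X0 := enorm_ge0 x.
have hr := grad_radial UC2 grad0 L0 hessL m0 K0 hessm x.
have hG : enorm (grad U x) ^+ 2 <= (L * enorm x) ^+ 2.
  rewrite ler_sqr ?nnegrE ?enorm_ge0 ?mulr_ge0//.
  exact: (grad_le UC2 grad0 L0 hessL x).
move: X0 hr hG; move: (dotv _ x) (enorm (grad U x) ^+ 2) (enorm x) => q G X X0 hr hG.
have e1 : g * (m * X ^+ 2 - B * X) <= g * q by rewrite ler_pM2l.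
have e2 : g ^+ 2 * G <= g * (g * L ^+ 2) * X ^+ 2.
  have -> : g * (g * L ^+ 2) * X ^+ 2 = g ^+ 2 * (L * X) ^+ 2 by ring.
  by rewrite ler_wpM2l// sqr_ge0.
have e3 : g * (g * L ^+ 2) * X ^+ 2 <= g * (m / 2) * X ^+ 2.
  by rewrite ler_wpM2r ?sqr_ge0// ler_pM2l.
have gm0 : 0 < g * m by rewrite mulr_gt0.
have e4 : X ^+ 2 + 2 * - g * q + (- g) ^+ 2 * G <=
   (1 - 3 / 2 * (g * m)) * X ^+ 2 + 2 * (g * B * X) by rewrite sqrrN; lra.
have e5 : (1 + g * m / 2) * (X ^+ 2 + 2 * - g * q + (- g) ^+ 2 * G) <=
  (1 + g * m / 2) * ((1 - 3 / 2 * (g * m)) * X ^+ 2 + 2 * (g * B * X)).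
  by rewrite ler_wpM2l//; lra.
apply: le_trans e5 _.
have e6 : 0 <= (g * m) ^+ 2 * X ^+ 2 by rewrite mulr_ge0 ?sqr_ge0.
have e7 : g * m * (g * B * X) <= 1 * (g * B * X).
  by apply: ler_wpM2r => //; apply: mulr_ge0 => //; apply: mulr_ge0 => //; exact: ltW.
have -> : (1 + g * m / 2) * ((1 - 3 / 2 * (g * m)) * X ^+ 2 + 2 * (g * B * X)) =
  X ^+ 2 - g * m * X ^+ 2 - 3 / 4 * ((g * m) ^+ 2 * X ^+ 2)
  + 2 * (g * B * X) + g * m * (g * B * X) by field.
by lra.
Qed.

(** Bound [|y|] by Euler step [b] plus noise [w]. In terms of [u = 1 / (8 g)] the proposal supplies
    [2 u w^2]; the cross term takes [u w^2], and [eta w^2] at most half of that, so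
    [u / 2 = 1 / (16 g)] is left. *)
Lemma V_prop_dens_le x y : V y * prop_dens U g x y <=
  normalizer * expR (drift_exponent x) *
  expR (- ((16 * g)^-1 * enorm (y - (x - g *: grad U x)) ^+ 2)).
Proof.
rewrite /= prop_densE [leLHS]mulrCA -[leRHS]mulrA ler_pM2l ?powR_gt0// -!expRD ler_expR.
have hb := euler_step_le x.
have : enorm y <= enorm (x - g *: grad U x) + enorm (y - (x - g *: grad U x)).
  by rewrite -{1}(subrK (x - g *: grad U x) y) addrC; exact: enormD.
have := enorm_ge0 (x - g *: grad U x); have := enorm_ge0 (y - (x - g *: grad U x)).
have := enorm_ge0 y.
move: hb; move: (enorm (x - _)) (enorm (y - _)) (enorm y) (enorm x) => b w Y X.
move=> hb Y0 w0 b0 hY.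
pose u := (8 * g)^-1.
have u0 : 0 < u by rewrite invr_gt0 mulr_gt0.
have gu : g * u = 1 / 8 by rewrite /u; field; rewrite gt_eqF.
have -> : (4 * g)^-1 = 2 * u by rewrite /u; field; rewrite gt_eqF.
have -> : (16 * g)^-1 = u / 2 by rewrite /u; field; rewrite gt_eqF.
clearbody u.
have etau : eta <= u / 2.
  by rewrite -(ler_pM2l g0) (mulrA g u) gu (mulrA g m); have := gm; lra.
have eta0 : 0 < eta by rewrite divr_gt0.
have e1 : eta * Y ^+ 2 <= eta * (b + w) ^+ 2.
  by rewrite ler_pM2l// ler_sqr ?nnegrE// addr_ge0.
(* Young's inequality; with [eta = m / 16] and [g * u = 1 / 8] the difference, times [u], is exactly
   a square. *)
have e2 : 2 * eta * b * w <= eta * (g * m / 2) * b ^+ 2 + u * w ^+ 2.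
  rewrite -subr_ge0 -(pmulr_rge0 _ u0).
  have -> : u * (eta * (g * m / 2) * b ^+ 2 + u * w ^+ 2 - 2 * eta * b * w) =
    (g * u) * (eta * m / 2) * b ^+ 2 + (u * w) ^+ 2 - 2 * eta * b * (u * w) by ring.
  rewrite gu.
  have -> : 1 / 8 * (eta * m / 2) * b ^+ 2 + (u * w) ^+ 2 - 2 * eta * b * (u * w) =
    (eta * b - u * w) ^+ 2 by field.
  exact: sqr_ge0.
have e3 : eta * ((1 + g * m / 2) * b ^+ 2) <=
    eta * (X ^+ 2 - g * (m * X ^+ 2 - 3 * B * X)) by rewrite ler_pM2l.
have e4 : eta * w ^+ 2 <= u / 2 * w ^+ 2 by rewrite ler_wpM2r// sqr_ge0.
rewrite sqrrD in e1; lra.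
Qed.

Let V1 x : 1 <= V x.
Proof. by rewrite /= -expR0 ler_expR mulr_ge0 ?sqr_ge0// divr_ge0// ltW. Qed.

Let mV : meas_fun V.
Proof.
rewrite /meas_fun /comp; apply: measurableT_comp => //; apply: measurable_funM => //.
under eq_fun do rewrite enorm_sqr_sum.
apply: measurable_sum => i; apply: measurable_funX.
under eq_fun do rewrite mxE.
exact: measurable_tnth.
Qed.

Let mprop x : meas_fun (prop_dens U g x).
Proof. by apply: meas_fun2_section; exact: meas_fun2_prop_dens. Qed.

Let mmove x : meas_fun (move_dens U g x).
Proof. by apply: meas_fun2_section; exact: meas_fun2_move_dens. Qed.

Lemma leb_int_V_prop_dens_le x : (leb_int (fun y => (V y * prop_dens U g x y)%:E) <=
  (normalizer * expR (drift_exponent x) * Num.sqrt (pi / (16 * g)^-1) ^+ d)%:E)%E.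
Proof.
apply: leb_int_le_gauss.
- by apply: measurable_funM => //; exact: mprop.
- by move=> y; rewrite mulr_ge0 ?expR_ge0// ltW// prop_dens_gt0.
- by rewrite mulr_ge0 ?expR_ge0// powR_ge0.
- by rewrite invr_gt0 mulr_gt0.
- by move=> y; exact: V_prop_dens_le.
Qed.

Let weight_prop_dens x : weight V (prop_dens U g x).
Proof.
split.
- exact: mprop.
- by move=> y; rewrite ltW// prop_dens_gt0.
- exact: le_lt_trans (leb_int_V_prop_dens_le x) (ltry _).
Qed.

Let weight_move_dens x : weight V (move_dens U g x).
Proof.
apply: (@le_weight _ _ V mV V1 (move_dens U g x) (prop_dens U g x) 1) => //.
- by move=> y; exact: move_dens_ge0.
- by move=> y; rewrite mul1r move_dens_le.
Qed.

Let coneV : function_cone (Vcone V). Proof. exact: Vcone_cone. Qed.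

Let cone1 : Vcone V (fun=> 1). Proof. exact: (cone_cst coneV). Qed.

Lemma acceptance_prob_le1 x : wint (move_dens U g x) (fun=> 1) <= 1.
Proof.
apply: (@le_trans _ _ (wint (prop_dens U g x) (fun=> 1))).
  by apply: (le_wint (V := V)) => // y; exact: move_dens_le.
rewrite -lee_fin -(wintE (V := V))//.
by under eq_leb_int do rewrite mul1r; rewrite leb_int_prop_dens.
Qed.

(* [mala_op] on functions with finite integrals, as a real-valued operator. *)
Definition mala_real (f : vec -> R) (x : vec) : R :=
  wint (move_dens U g x) f + f x * (1 - wint (move_dens U g x) (fun=> 1)).

Lemma mala_real_functional x : cone_functional (Vcone V) (mala_real ^~ x).
Proof.
have [l0 lD lZ] := wint_functional mV V1 (weight_move_dens x).
have a1 := acceptance_prob_le1 x.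
split.
- move=> f Df; rewrite addr_ge0 ?l0// mulr_ge0 ?subr_ge0//.
  exact: (cone_ge0 coneV).
- by move=> f h Df Dh; rewrite /mala_real lD//; ring.
- by move=> c f c0 Df; rewrite /mala_real lZ//; ring.
Qed.

Lemma mala_real1 x : mala_real (fun=> 1) x = 1.
Proof. by rewrite /mala_real mul1r addrC subrK. Qed.

(** Far out, a move is accepted with probability at least [p] while accepted moves carry at most
    [p / 2 * V x], so [V] shrinks by [1 - p / 2]. On the remaining ball everything is bounded. *)
Lemma mala_drift : exists lam b, [/\ 0 <= lam, lam < 1, 0 <= b &
  forall x, mala_real V x <= lam * V x + b].
Proof.
pose A := normalizer * Num.sqrt (pi / (16 * g)^-1) ^+ d.
have A0 : 0 <= A by rewrite mulr_ge0 ?powR_ge0// exprn_ge0// sqrtr_ge0.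
have prop_le x : wint (move_dens U g x) V <= A * expR (drift_exponent x).
  apply: (@le_trans _ _ (wint (prop_dens U g x) V)).
    apply: (le_wint (V := V)) => //; first exact: Vcone_V.
    by move=> y; exact: move_dens_le.
  rewrite -lee_fin -(wintE (V := V))//; last exact: Vcone_V.
  by rewrite (le_trans (leb_int_V_prop_dens_le x))// lee_fin /A mulrAC.
have [rho1 rho10 boxle] := move_dens_ge_unit_box.
pose p := normalizer * expR (- (d%:R / (4 * g))).
have p0 : 0 < p by rewrite mulr_gt0 ?expR_gt0// powR_gt0.
have acc_ge x : rho1 <= enorm x -> p <= wint (move_dens U g x) (fun=> 1).
  move=> hx; set b := x - g *: grad U x.
  have Wb : (1%:E <= leb_int (fun y => (1 * unit_box b y)%:E))%E.
    by under eq_leb_int do rewrite mul1r; rewrite leb_int_unit_box.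
  have mb := meas_unit_box b.
  rewrite -lee_fin -(wintE (V := V))//.
  apply: (@le_trans _ _ (leb_int (fun y => p%:E * (unit_box b y)%:E)%E)).
    rewrite leb_intZl ?(ltW p0)//; last exact/(@meas_fun_EFin R d).
      by rewrite leb_int_unit_box mule1.
    by move=> y; rewrite lee_fin unit_box_ge0.
  apply: le_leb_int.
  - by move=> y; rewrite -EFinM lee_fin mulr_ge0 ?unit_box_ge0// ltW.
  - move=> y; rewrite -EFinM lee_fin mul1r.
    have [->|yb] := eqVneq (unit_box b y) 0; first by rewrite mulr0 move_dens_ge0.
    apply: le_trans (boxle x y hx yb).
    by rewrite -/p ler_piMr ?unit_box_le1// ltW.
  - rewrite /emeas_fun /comp; apply: measurable_funeM.
    exact/(@meas_fun_EFin R d).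
  - apply/(@meas_fun_EFin R d); apply: measurable_funM => //.
    exact: mmove.
(* Beyond [rho1] acceptance is at least [p]. The second summand gives [s >= eta g |x|] for the decay
   [s] of the exponent, and the third then gives [s >= 2 A / p], whence [A expR (- s) <= p / 2]. *)
pose rho := rho1 + (3 * B + 1) / m + 2 * A / (p * (eta * g)).
have eg0 : 0 < eta * g by rewrite mulr_gt0// divr_gt0.
have pe0 : 0 < p * (eta * g) by rewrite mulr_gt0.
have t1 : 0 <= (3 * B + 1) / m by apply: divr_ge0 (ltW m0); apply: addr_ge0 => //; apply: mulr_ge0.
have t2 : 0 <= 2 * A / (p * (eta * g)) by apply: divr_ge0 (ltW pe0); apply: mulr_ge0.
have rho0 : 0 <= rho by rewrite !addr_ge0.
have r1 : rho1 <= rho by rewrite /rho -addrA lerDl addr_ge0.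
have r2 : (3 * B + 1) / m <= rho by rewrite /rho addrAC lerDr addr_ge0.
have r3 : 2 * A / (p * (eta * g)) <= rho by rewrite /rho lerDr addr_ge0.
clearbody rho.
pose bb := A * expR (eta * rho ^+ 2 + eta * g * (3 * B * rho)) + expR (eta * rho ^+ 2).
have bb0 : 0 <= bb.
  by apply: addr_ge0 (expR_ge0 _); apply: mulr_ge0 (expR_ge0 _).
(* The maximum with 0 secures a nonnegative rate without an upper bound on [p]. *)
exists (Num.max 0 (1 - p / 2)), bb; split.
- by rewrite le_max lexx.
- by rewrite gt_max ltr01 /= ltrBlDr ltrDl divr_gt0.
- exact: bb0.
move=> x; rewrite /mala_real.
have Vx0 : 0 <= V x by exact: expR_ge0.
have acc0 : 0 <= wint (move_dens U g x) (fun=> 1).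
  exact: (functional_ge0 (wint_functional mV V1 (weight_move_dens x))).
have X0 := enorm_ge0 x.
have [hx|hx] := leP rho (enorm x).
  have hp : p <= wint (move_dens U g x) (fun=> 1).
    by apply: acc_ge; apply: le_trans hx.
  have hV : wint (move_dens U g x) V <= p / 2 * V x.
    apply: le_trans (prop_le x) _.
    pose s := eta * g * (m * enorm x ^+ 2 - 3 * B * enorm x).
    have -> : drift_exponent x = eta * enorm x ^+ 2 - s by [].
    rewrite expRD mulrCA mulrC ler_wpM2r//.
    have mx : 3 * B + 1 <= m * enorm x.
      by rewrite [leRHS]mulrC -ler_pdivrMr//; apply: le_trans hx.
    have sX : eta * g * enorm x <= s.
      rewrite ler_pM2l// expr2 mulrA -mulrBl ler_peMl//.
      by rewrite lerBrDr addrC.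
    have Ax : 2 * A / p <= s.
      apply: le_trans sX; rewrite [leRHS]mulrC -ler_pdivrMr// -[_ / p / _]mulrA -invfM.
      exact: le_trans hx.
    have es := expR_ge1Dx s.
    rewrite expRN ler_pdivrMr ?expR_gt0//.
    move: Ax; rewrite ler_pdivrMr// => Ax.
    have : p * (1 + s) <= p * expR s by rewrite ler_pM2l.
    by lra.
  have k1 : V x * p <= V x * wint (move_dens U g x) (fun=> 1) by rewrite ler_wpM2l.
  have k2 : (1 - p / 2) * V x <= Num.max 0 (1 - p / 2) * V x.
    by rewrite ler_wpM2r// le_max lexx orbT.
  by move: hV k1 k2 bb0; rewrite /=; lra.
have Xr : enorm x ^+ 2 <= rho ^+ 2 by rewrite ler_sqr ?nnegrE// ltW.
have h1 : wint (move_dens U g x) V <= A * expR (eta * rho ^+ 2 + eta * g * (3 * B * rho)).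
  apply: le_trans (prop_le x) _; rewrite ler_wpM2l// ler_expR.
  have a1 : eta * enorm x ^+ 2 <= eta * rho ^+ 2 by rewrite ler_pM2l// divr_gt0.
  have a2 : eta * g * (3 * B * enorm x) <= eta * g * (3 * B * rho).
    rewrite ler_pM2l//; apply: ler_wpM2l (ltW hx).
    exact: (mulr_ge0 _ B0).
  have a3 : 0 <= eta * g * (m * enorm x ^+ 2).
    by apply: mulr_ge0 (ltW eg0) _; apply: mulr_ge0 (ltW m0) (sqr_ge0 _).
  by rewrite (mulrBr (eta * g)); lra.
have h2 : V x <= expR (eta * rho ^+ 2).
  by rewrite ler_expR ler_pM2l// divr_gt0.
have h3 : V x * (1 - wint (move_dens U g x) (fun=> 1)) <= V x.
  by rewrite ler_piMr// lerBlDr lerDl.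
have h4 : 0 <= Num.max 0 (1 - p / 2) * V x by rewrite mulr_ge0// le_max lexx.
by rewrite /bb; move: h1 h2 h3 h4; rewrite /=; lra.
Qed.

Lemma meas_wint_move_dens f : Vcone V f -> meas_fun (fun x => wint (move_dens U g x) f).
Proof.
move=> [mf f0 _].
have mk : emeas_fun (fun x => leb_int (fun y => (f y * move_dens U g x y)%:E)).
  apply: (emeas_fun_leb_int (k := fun x y => f y * move_dens U g x y)).
    by move=> x y; rewrite mulr_ge0 ?move_dens_ge0.
  apply: measurable_funM; first exact: meas_fun2_snd.
  exact: meas_fun2_move_dens.
have mfine : measurable_fun [set: \bar R] (@fine R) by exact: fine_measurable.
exact: (measurableT_comp mfine mk).
Qed.

(** The drift inequality preserves growth of order [V], because [lam V + b <= (lam + b) V]. *)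
Lemma mala_real_cone f : Vcone V f -> Vcone V (mala_real f).
Proof.
move=> Df; have [mf f0 [C fC]] := Df; split.
- apply: measurable_funD; first exact: meas_wint_move_dens.
  apply: measurable_funM => //; apply: measurable_funB => //.
  exact: meas_wint_move_dens.
- by move=> x; exact: (functional_ge0 (mala_real_functional x)).
have [lam [b [lam0 _ b0 dr]]] := mala_drift.
exists (`|C| * (lam + b)) => x.
have DV : Vcone V V by exact: Vcone_V.
apply: (@le_trans _ _ (mala_real (fun y => `|C| * V y) x)).
  apply: (le_functional coneV (mala_real_functional x)) => //.
    exact: (coneZ coneV).
  move=> y; apply: le_trans (fC y) _.
  by rewrite ler_wpM2r ?expR_ge0// ler_norm.
rewrite (functionalZ (mala_real_functional x))// -[leRHS]mulrA ler_wpM2l//.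
apply: le_trans (dr x) _; rewrite mulrDl lerD2l ler_peMr//; exact: V1.
Qed.

(** For [x] in a sublevel set and [y] in the unit cube at the origin, both points are bounded, so
    both entries of the minimum in [move_dens] have positive lower bounds, [e1] and [e2]. *)
Lemma mala_minorization (r : R) : exists (eps : R) (nu : (vec -> R) -> R),
  [/\ 0 < eps, cone_functional (Vcone V) nu, nu (fun=> 1) = 1 &
      forall f x, Vcone V f -> V x <= r -> eps * nu f <= mala_real f x].
Proof.
pose X := Num.sqrt (`|r| / eta); pose Y : R := Num.sqrt d%:R.
have eta0 : 0 < eta by rewrite divr_gt0.
have X0 : 0 <= X by exact: sqrtr_ge0.
have Y0 : 0 <= Y by exact: sqrtr_ge0.
(* Bounds the Gaussian part of a move in either direction, since start point and displacement both
   have norm at most [X + Y]. *)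
pose M := X + Y + g * (L * (X + Y)).
have c0 : 0 < normalizer by exact: powR_gt0.
pose e1 := normalizer * expR (- (M ^+ 2 / (4 * g))).
pose e2 := expR (- (L * X ^+ 2 + L * Y ^+ 2)) * e1.
have e10 : 0 < e1 by rewrite mulr_gt0 ?expR_gt0.
have e20 : 0 < e2 by rewrite mulr_gt0 ?expR_gt0.
have prop_ge x y : enorm x <= X + Y -> enorm (y - x) <= X + Y -> e1 <= prop_dens U g x y.
  move=> hx hxy; rewrite /prop_dens ler_pM2l// ler_expR mulNr lerN2.
  rewrite ler_pM2r ?invr_gt0 ?mulr_gt0// ler_sqr ?nnegrE ?enorm_ge0//; last first.
    by rewrite addr_ge0 ?addr_ge0// mulr_ge0 ?(ltW g0)// mulr_ge0 ?addr_ge0.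
  apply: le_trans (enormD _ _) _; apply: lerD => //.
  rewrite enormZ (ger0_norm (ltW g0)) ler_pM2l//.
  apply: le_trans (grad_le UC2 grad0 L0 hessL x) _.
  by rewrite ler_wpM2l.
pose eps := Num.min e1 e2.
have eps0 : 0 < eps by rewrite lt_min e10.
have mb := @meas_unit_box R d 0.
have Wb : weight V (unit_box 0).
  split => //; first exact: unit_box_ge0.
  apply: le_lt_trans (ltry (expR (eta * Y ^+ 2))).
  rewrite -[leRHS]mule1 -(@leb_int_unit_box R d 0) -leb_intZl ?expR_ge0//; last first.
  - exact/(@meas_fun_EFin R d).
  - by move=> y; rewrite lee_fin unit_box_ge0.
  apply: le_leb_int.
  - by move=> y; rewrite lee_fin mulr_ge0 ?expR_ge0 ?unit_box_ge0.
  - move=> y; rewrite -EFinM lee_fin.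
    have [->|/unit_box_neq0] := eqVneq (unit_box 0 y) 0; first by rewrite !mulr0.
    rewrite subr0 -/Y => yY.
    by rewrite ler_wpM2r ?unit_box_ge0// ler_expR ler_pM2l// ler_sqr ?nnegrE ?enorm_ge0.
  - by apply/(@meas_fun_EFin R d); exact: measurable_funM.
  - rewrite /emeas_fun /comp; apply: measurable_funeM.
    exact/(@meas_fun_EFin R d).
exists eps, (wint (unit_box 0)); split => //.
- exact: wint_functional.
- rewrite /wint; under eq_leb_int do rewrite mul1r.
  by rewrite leb_int_unit_box.
move=> f x Df Vr; have [mf f0 _] := Df.
have xX : enorm x <= X.
  rewrite -(@ler_pXn2r _ 2)// ?nnegrE ?enorm_ge0//.
  rewrite [leRHS](@sqr_sqrtr _ (`|r| / eta)); last by rewrite divr_ge0// ltW.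
  (* [expR z >= 1 + z] gives [eta |x|^2 <= V x <= r]. *)
  rewrite ler_pdivlMr// mulrC; apply: le_trans (ler_norm r).
  by apply: le_trans Vr; apply: le_trans (expR_ge1Dx _); rewrite lerDr.
apply: (@le_trans _ _ (wint (move_dens U g x) f)); last first.
  rewrite lerDl mulr_ge0// subr_ge0; exact: acceptance_prob_le1.
rewrite -(wintZ mV V1 Wb Df (ltW eps0)).
apply: (le_wint mV V1) => //.
  apply: (le_weight mV V1 _ _ (ltW eps0) Wb) => //; first exact: measurable_funM.
  by move=> y; rewrite mulr_ge0 ?unit_box_ge0// ltW.
move=> y.
have [->|yb] := eqVneq (unit_box 0 y) 0; first by rewrite mulr0 move_dens_ge0.
apply: (@le_trans _ _ eps); first by rewrite ler_piMr ?unit_box_le1// ltW.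
have := unit_box_neq0 yb; rewrite subr0 -/Y => yY.
have xy : enorm (y - x) <= X + Y.
  apply: le_trans (enormD _ _) _; rewrite enormN addrC; exact: lerD.
have yx : enorm (x - y) <= X + Y by rewrite -enormN opprB.
have hx : enorm x <= X + Y by apply: le_trans xX _; rewrite lerDl.
have hy : enorm y <= X + Y by apply: le_trans yY _; rewrite lerDr.
rewrite le_min; apply/andP; split.
  by apply: le_trans (prop_ge x y hx xy); rewrite ge_min lexx.
apply: (@le_trans _ _ e2); first by rewrite ge_min lexx orbT.
apply: ler_pM; [exact: expR_ge0|exact: ltW| |exact: prop_ge].
rewrite ler_expR.
have Ux : `|U x - U 0| <= L * X ^+ 2.
  apply: le_trans (potential_dist UC2 grad0 L0 hessL x) _.
  by rewrite ler_wpM2l// ler_sqr ?nnegrE ?enorm_ge0.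
have Uy : `|U y - U 0| <= L * Y ^+ 2.
  apply: le_trans (potential_dist UC2 grad0 L0 hessL y) _.
  by rewrite ler_wpM2l// ler_sqr ?nnegrE ?enorm_ge0.
move: Ux Uy; rewrite !ler_norml => /andP[? ?] /andP[? ?]; lra.
Qed.

(** * Integrability, normalization and invariance of the target *)

Let mexpU : meas_fun (fun x => expR (- U x)).
Proof.
apply: measurableT_comp => //; apply: measurableT_comp => //.
by apply: continuous_meas_fun => x; apply: differentiable_continuous; exact: UC2.1.
Qed.

(** The growth [m / 2 |y|^2] of [U] absorbs both [eta |y|^2] and the linear loss [B |y|], leaving a
    Gaussian of rate [m / 8]. *)
Lemma weight_expU : weight V (fun x => expR (- U x)).
Proof.
split => //.
have m8 : 0 < m / 8 by rewrite divr_gt0.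
apply: le_lt_trans (ltry (expR (- U 0 + 2 * B ^+ 2 / m) * Num.sqrt (pi / (m / 8)) ^+ d)).
apply: (leb_int_le_gauss (b := 0)) => //.
  exact: measurable_funM.
move=> y; rewrite subr0 -!expRD ler_expR.
have := potential_ge UC2 grad0 L0 hessL m0 K0 hessm y.
have := enorm_ge0 y; move: (enorm y) (U y) (U 0) => t u1 u0 t0 hu.
(* This square yields [B t <= m / 8 t^2 + 2 B^2 / m]. *)
have : 0 <= (m * t - 4 * B) ^+ 2 / (8 * m).
  by apply: divr_ge0 (sqr_ge0 _) _; rewrite mulr_ge0// ltW.
have -> : (m * t - 4 * B) ^+ 2 / (8 * m) = m / 8 * t ^+ 2 + 2 * B ^+ 2 / m - B * t.
  by field; rewrite gt_eqF.
have : 0 <= m * t ^+ 2 by rewrite mulr_ge0 ?sqr_ge0// ltW.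
by move: (2 * B ^+ 2 / m) => z; lra.
Qed.

(** Finiteness comes from [weight_expU], positivity from a Gaussian lower bound of [expR (- U x)];
    the rate [L + 1] is positive even when [L = 0]. *)
Lemma Zconst_gt0 : 0 < Zconst U.
Proof.
have E : leb_int (fun x => (expR (- U x))%:E) = (Zconst U)%:E.
  have := wintE mV V1 weight_expU cone1; rewrite /Zconst /wint.
  by under eq_leb_int do rewrite mul1r.
have L1 : 0 < L + 1 by rewrite ltr_wpDl.
have me : emeas_fun (fun y : vec => (expR (- ((L + 1) * enorm (y - 0) ^+ 2)))%:E).
  by apply/(@meas_fun_EFin R d); exact: meas_gauss.
rewrite -lte_fin -E.
apply: (@lt_le_trans _ _ ((expR (- U 0))%:E * leb_int (fun y : vec =>
    (expR (- ((L + 1) * enorm (y - 0) ^+ 2)))%:E))%E).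
  rewrite leb_int_gauss// -EFinM lte_fin mulr_gt0 ?expR_gt0// exprn_gt0// sqrtr_gt0.
  by rewrite divr_gt0// pi_gt0.
rewrite -leb_intZl//.
apply: le_leb_int.
- by move=> y; rewrite -EFinM lee_fin mulr_ge0 ?expR_ge0.
- move=> y; rewrite -EFinM lee_fin -expRD ler_expR subr0.
  have := potential_dist UC2 grad0 L0 hessL y; rewrite ler_norml => /andP[_].
  by have := sqr_ge0 (enorm y); lra.
- by rewrite /emeas_fun /comp; apply: measurable_funeM; exact: me.
- exact/(@meas_fun_EFin R d).
Qed.

Lemma weight_dens : weight V (dens U).
Proof.
have Z0 : 0 <= (Zconst U)^-1 by rewrite invr_ge0 ltW// Zconst_gt0.
apply: (le_weight mV V1 _ _ Z0 weight_expU).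
- exact: measurable_funM.
- by move=> x; rewrite mulr_ge0 ?expR_ge0.
- by move=> x; rewrite mulrC.
Qed.

Lemma wint_dens1 : wint (dens U) (fun=> 1) = 1.
Proof.
have Z0 : 0 <= (Zconst U)^-1 by rewrite invr_ge0 ltW// Zconst_gt0.
have -> : dens U = fun x => (Zconst U)^-1 * expR (- U x).
  by apply/funext => x; rewrite mulrC.
rewrite (wintZ mV V1 weight_expU cone1 Z0).
have -> : wint (fun x => expR (- U x)) (fun=> 1) = Zconst U.
  by rewrite /wint /Zconst; under eq_leb_int do rewrite mul1r.
by rewrite mulVf// gt_eqF// Zconst_gt0.
Qed.

(** Tonelli and detailed balance turn the integral of the accepted part into that of [f * acc]; the
    rejected part supplies [f * (1 - acc)]. *)
Lemma mala_invariant f : Vcone V f -> wint (dens U) (mala_real f) = wint (dens U) f.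
Proof.
move=> Df; have [mf f0 _] := Df.
have [md d0 _] := weight_dens.
pose acc x := wint (move_dens U g x) (fun=> 1).
have acc0 x : 0 <= acc x.
  exact: (functional_ge0 (wint_functional mV V1 (weight_move_dens x))).
have acc1 x : 0 <= 1 - acc x by rewrite subr_ge0 acceptance_prob_le1.
have macc : meas_fun acc by exact: meas_wint_move_dens.
have mwf := meas_wint_move_dens Df.
have wf0 x : 0 <= wint (move_dens U g x) f.
  exact: (functional_ge0 (wint_functional mV V1 (weight_move_dens x))).
apply: EFin_inj; rewrite -(wintE mV V1 weight_dens Df).
rewrite -(wintE mV V1 weight_dens (mala_real_cone Df)).
have E1 : leb_int (fun x => (wint (move_dens U g x) f * dens U x)%:E) =
    leb_int (fun x => (f x * acc x * dens U x)%:E).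
  transitivity (leb_int (fun x => leb_int (fun y =>
      (f y * move_dens U g x y * dens U x)%:E))).
    apply: eq_leb_int => x; rewrite EFinM -(wintE mV V1 (weight_move_dens x) Df).
    rewrite muleC -leb_intZl//.
    - by apply: eq_leb_int => y; rewrite -EFinM mulrC.
    - by move=> y; rewrite lee_fin mulr_ge0 ?move_dens_ge0.
    - by apply/(@meas_fun_EFin R d); exact: measurable_funM mf (mmove x).
  rewrite (leb_int_swap (k := fun x y => f y * move_dens U g x y * dens U x)); last 2 first.
  - by move=> x y; do 2 apply: mulr_ge0 => //; exact: move_dens_ge0.
  - apply: measurable_funM; last exact: meas_fun2_fst.
    apply: measurable_funM; first exact: meas_fun2_snd.
    exact: meas_fun2_move_dens.
  apply: eq_leb_int => y.
  have -> : f y * acc y * dens U y = f y * dens U y * acc y by rewrite mulrAC.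
  rewrite EFinM -(wintE mV V1 (weight_move_dens y) cone1) -leb_intZl//.
  - apply: eq_leb_int => x; rewrite -EFinM mul1r; congr EFin.
    by rewrite -[LHS]mulrA move_dens_reversible mulrCA mulrC.
  - by rewrite mulr_ge0.
  - by move=> x; rewrite lee_fin mul1r move_dens_ge0.
  - by apply/(@meas_fun_EFin R d); apply: measurable_funM => //; exact: mmove.
transitivity (leb_int (fun x => (wint (move_dens U g x) f * dens U x)%:E +
    (f x * (1 - acc x) * dens U x)%:E)%E).
  by apply: eq_leb_int => x; rewrite -EFinD -mulrDl.
have m1 : emeas_fun (fun x => (f x * (1 - acc x) * dens U x)%:E).
  apply/(@meas_fun_EFin R d); apply: measurable_funM => //.
  by apply: measurable_funM => //; exact: measurable_funB.
rewrite leb_intD//; last 3 first.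
- by move=> x; rewrite lee_fin mulr_ge0.
- by move=> x; rewrite lee_fin; do 2 apply: mulr_ge0 => //.
- by apply/(@meas_fun_EFin R d); exact: measurable_funM.
rewrite E1 -leb_intD//.
- by apply: eq_leb_int => x; rewrite -EFinD; congr EFin; ring.
- by move=> x; rewrite lee_fin; do 2 apply: mulr_ge0 => //.
- by move=> x; rewrite lee_fin; do 2 apply: mulr_ge0 => //.
- apply/(@meas_fun_EFin R d); apply: measurable_funM => //.
  exact: measurable_funM.
Qed.

(** * Geometric convergence of the MALA iterates *)

Lemma mala_op_EFin f : Vcone V f ->
  mala_op U g (EFin \o f) = EFin \o mala_real f.
Proof.
move=> Df; apply/funext => x; rewrite /mala_op /=.
have Z0 := Zconst_gt0.
under eq_leb_int do rewrite (accept_prop_dens g0)// -EFinM.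
rewrite (wintE mV V1 (weight_move_dens x) Df).
under eq_leb_int do rewrite (accept_prop_dens g0)// -[X in X%:E]mul1r.
by rewrite (wintE mV V1 (weight_move_dens x) cone1).
Qed.

Lemma iter_mala_op k f : Vcone V f ->
  Vcone V (iter k mala_real f) /\
  iter k (mala_op U g) (EFin \o f) = EFin \o iter k mala_real f.
Proof.
move=> Df; elim: k => //= k [Dk ->]; split; first exact: mala_real_cone.
exact: mala_op_EFin.
Qed.

Lemma mala_geometric : exists C rho : R, 0 <= C /\ 0 <= rho < 1 /\
  forall x k, (Vnorm_dist U g V x k <= (C * rho ^+ k * V x)%:E)%E.
Proof.
have [lam [b [lam0 lam1 b0 dr]]] := mala_drift.
have DV : Vcone V V by exact: Vcone_V.
have Pifun := wint_functional mV V1 weight_dens.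
have [C [rho [C0 rho0 rho1 hC]]] := harris coneV mala_real_functional mala_real_cone
  mala_real1 DV V1 lam0 lam1 b0 dr mala_minorization Pifun wint_dens1 mala_invariant 0.
(* The factor 2 pays for the positive and negative parts of [f], each at most [V]. *)
exists (2 * C), rho; rewrite rho0 rho1; do !split => //; first by rewrite mulr_ge0.
move=> x k; apply: ge_ereal_sup => _ [f [mf fV] <-].
have part (h : vec -> R) : meas_fun h -> (forall y, `|h y| <= V y) ->
    Vcone V (fun y => Num.max (h y) 0) /\ (forall y, Num.max (h y) 0 <= V y).
  move=> mh hV.
  have hle y : Num.max (h y) 0 <= V y.
    by rewrite ge_max expR_ge0 andbT (le_trans _ (hV y))// ler_norm.
  split => //; split.
  - exact: measurable_maxr.
  - by move=> y; rewrite le_max lexx orbT.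
  - by exists 1 => y; rewrite mul1r.
have [Dp pV] := part _ mf fV.
have [Dn nV] : Vcone V (fun y => Num.max (- f y) 0) /\ (forall y, Num.max (- f y) 0 <= V y).
  apply: part; first exact: measurableT_comp.
  by move=> y; rewrite normrN.
rewrite /mala_iter_int (_ : pos_part f = EFin \o (fun y => Num.max (f y) 0))//.
rewrite (_ : neg_part f = EFin \o (fun y => Num.max (- f y) 0))//.
rewrite (iter_mala_op k Dp).2 (iter_mala_op k Dn).2 /pi_int.
rewrite (wintE mV V1 weight_dens Dp) (wintE mV V1 weight_dens Dn) /= lee_fin.
have := hC _ Dp pV k x; have := hC _ Dn nV k x.
rewrite !ler_norml => /andP[? ?] /andP[? ?]; apply/andP; split; lra.
Qed.

End mala_drift.

(** * The explicit step-size threshold *)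

Unset Implicit Arguments.

Theorem theorem1 (R : realType) (d : nat) (U : 'rV[R]_d -> R) (L m K : R) :
  C2 U -> grad U 0 = 0 -> 0 <= L ->
  (forall x y z, `|hess U x y z| <= L * enorm y * enorm z) ->
  0 < m -> 0 <= K ->
  (forall x y, K <= enorm x -> enorm y = 1 -> m <= hess U x y y) ->
  let eta := m / 16 in
  let V := fun x : 'rV[R]_d => expR (eta * enorm x ^+ 2) in
  exists Gam : R, 0 < Gam /\
    forall g : R, 0 < g -> g <= Gam ->
      exists C rho : R, 0 <= C /\ 0 <= rho < 1 /\
        forall (x : 'rV[R]_d) (k : nat),
          (Vnorm_dist U g V x k <= (C * rho ^+ k * V x)%:E)%E.
Proof.
move=> UC2 grad0 L0 hessL m0 K0 hessm eta V.
(* If [g * S <= 1], each of the nonnegative terms [g m], [2 g L] and [2 g L^2 / m] is at most 1,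
   which gives the three step-size conditions. *)
pose S := m + 2 * L + 2 * (L ^+ 2 / m) + 1.
have Lm : 0 <= L ^+ 2 / m by rewrite divr_ge0 ?sqr_ge0// ltW.
have S0 : 0 < S by rewrite /S; move: (L ^+ 2 / m) Lm => z z0; lra.
exists S^-1; split; first by rewrite invr_gt0.
move=> g g0; rewrite -[S^-1]mul1r ler_pdivlMr// => gS.
have t1 : 0 <= g * m by rewrite mulr_ge0// ltW.
have t2 : 0 <= g * L by rewrite mulr_ge0// ltW.
have t3 : 0 <= g * (L ^+ 2 / m) by rewrite mulr_ge0// ltW.
rewrite !mulrDr in gS.
have gm : g * m <= 1 by lra.
have gL : g * L <= 1 / 2 by lra.
have gLL : g * L ^+ 2 <= m / 2.
  have : g * (L ^+ 2 / m) <= 1 / 2 by lra.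
  by rewrite mulrA ler_pdivrMr//; lra.
exact: mala_geometric UC2 grad0 L0 hessL m0 K0 hessm g0 gLL gL gm.
Qed.
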